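(* Let $W=\{W_t\}_{t\ge 0}$ be a standard one-dimensional Brownian motion with $W_0=0$. Then $\phi(W)$ is also a standard one-dimensional Brownian motion, where $\phi$ is the quasi-time reversal defined below.
   Context: Let $\mathbb{W}$ be the space of continuous paths $w:[0,\infty)\to\mathbb{R}$. For $w\in\mathbb{W}$ let $\tau(w)=\inf\{t\ge0:|w(t)|=1\}$ (hitting time of $\pm1$) and $g_\tau(w)=\sup\{0\le t<\tau(w): w(t)=0\}$ (last zero before $\tau$). The quasi-time reversal $\phi:\mathbb{W}\to\mathbb{W}$ is defined by $$\phi(w)(t)=\begin{cases} w(t), & 0\le t<g_\tau(w),\\ w(g_\tau+\tau-t)-1, & w(\tau)=1,\ g_\tau(w)\le t<\tau(w),\\ w(g_\tau+\tau-t)+1, & w(\tau)=-1,\ g_\tau(w)\le t<\tau(w),\\ w(t)-2, & w(\tau)=1,\ t\ge\tau(w),\\ w(t)+2, & w(\tau)=-1,\ t\ge \tau(w).\end{cases}$$ (Here $g_\tau,\tau$ stand for $g_\tau(w),\tau(w)$.) *)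

(* Defs.v *)
From HB Require Import structures.
From mathcomp Require Import all_boot all_order all_algebra.
From mathcomp Require Import all_classical all_reals all_analysis.
Set Implicit Arguments. Unset Strict Implicit. Unset Printing Implicit Defensive.
Import Order.TTheory GRing.Theory Num.Theory.
Import numFieldNormedType.Exports.
Local Open Scope classical_set_scope.
Local Open Scope ring_scope.

Section QuasiTimeReversal.
Variable R : realType.

Definition hit_set (w : R -> R) : set R := [set t | 0 <= t /\ `|w t| = 1].

Definition tau (w : R -> R) : R := inf (hit_set w).

Definition gtau (w : R -> R) : R :=
  sup [set t | 0 <= t /\ t < tau w /\ w t = 0].

(* The quasi-time reversal phi.  On paths that never hit +-1 (tau = +oo)
   the paper's formula reduces to (or is only meaningful as) the identity;
   we set phi(w) = w there (a null event for Brownian motion). *)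
Definition qtr (w : R -> R) : R -> R := fun t =>
  if `[< hit_set w !=set0 >] then
    let ta := tau w in let g := gtau w in
    if t < g then w t
    else if t < ta then
      (if w ta == 1 then w (g + ta - t) - 1 else w (g + ta - t) + 1)
    else (if w ta == 1 then w t - 2 else w t + 2)
  else w t.

End QuasiTimeReversal.

(* Standard one-dimensional Brownian motion on [0, oo) started at 0:
   measurable coordinates, W_0 = 0, continuous paths on [0, oo), and for all
   times 0 <= t_0 < t_1 < ... < t_n the increments W_{t_{i+1}} - W_{t_i}
   are independent with law N(0, t_{i+1} - t_i) (normal_prob takes the
   standard deviation). *)
Definition is_brownian_motion {d : measure_display} {T : measurableType d}
    {R : realType} (P : probability T R) (W : T -> R -> R) : Prop :=
  [/\ (forall t, 0 <= t -> measurable_fun setT (fun om => W om t)),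
      (forall om, W om 0 = 0),
      (forall om, {within `[0, +oo[, continuous (W om)}) &
      (forall (n : nat) (ts : nat -> R) (B : nat -> set R),
         0 <= ts 0%N ->
         (forall i, (i < n)%N -> ts i < ts i.+1) ->
         (forall i, (i < n)%N -> measurable (B i)) ->
         P (\bigcap_(i in `I_n) [set om | B i (W om (ts i.+1) - W om (ts i))])
         = (\prod_(i < n) normal_prob 0 (Num.sqrt (ts i.+1 - ts i)) (B i))%E)].

(* Main.v *)
Require Import Defs.
From HB Require Import structures.
From mathcomp Require Import all_boot all_order all_algebra.
From mathcomp Require Import all_classical all_reals all_analysis.
From mathcomp Require Import measurable_realfun ring lra zify.

(* Fix [e = 1/n] and sample the path on a grid of mesh [1/N].  Cut the sequence
   of increments greedily into blocks: a block is a minimal run of increments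
   whose sum has absolute value at least [e].  The signs of the blocks drive an
   integer walk shadowing [W/e], and its last visit to a level near 0 before it
   exits a window slightly smaller than [-n, n] shadows [gtau].  Listing the
   blocks between this visit and the exit in the reverse order, and negating
   every increment in them, is a signed permutation of i.i.d. symmetric Gaussian
   increments.  Negation preserves blocks, so once the block lengths and signs
   are known the operation can be undone; it therefore exchanges, with the same
   law, paths leaving through the top with paths leaving through the bottom.
   Inside a block the path moves by at most about [e], so reversing the order of
   the blocks is uniformly close to reversing time.  Letting N, then n, tend to
   infinity, the transformed paths converge to [qtr W] for every continuous path
   (no null set is discarded), and a Fatou argument compares the two laws.

   The walk is watched around level 8 rather than 0 because the zero of a path
   is not stable under approximation: the last visit to a small positive level
   before hitting 1 is.  The price is that a path hitting -1 need not visit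
   level 8, so that the limit yields inequalities only; applied to [W] and to
   [-W], and to a functional and to its opposite, they give the equality of
   laws. *)

Set Implicit Arguments. Unset Strict Implicit. Unset Printing Implicit Defensive.
Import Order.TTheory GRing.Theory Num.Theory.
Import numFieldNormedType.Exports.
Local Open Scope classical_set_scope.
Local Open Scope ring_scope.

(** * Codes of block sequences *)

Section codes.
Implicit Types (a r : int).

(* A code lists the length and the sign of successive blocks; [level] is the
   position of the walk they drive. *)
Definition step (d : nat * bool) : int := if d.2 then 1 else -1.
Definition level (c : seq (nat * bool)) : int := \sum_(d <- c) step d.
Definition flip (c : seq (nat * bool)) := [seq (d.1, ~~ d.2) | d <- c].

Lemma level_nil : level [::] = 0.
Proof. by rewrite /level big_nil. Qed.

Lemma level_cons d c : level (d :: c) = step d + level c.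
Proof. by rewrite /level big_cons. Qed.

Lemma level_cat c1 c2 : level (c1 ++ c2) = level c1 + level c2.
Proof. by rewrite /level big_cat. Qed.

Lemma level_rev c : level (rev c) = level c.
Proof. by apply: perm_big; rewrite perm_rev. Qed.

Lemma level_flip c : level (flip c) = - level c.
Proof.
elim: c => [|[l b] c IHc]; first by rewrite level_nil oppr0.
by rewrite /= !level_cons IHc opprD; case: b.
Qed.

Lemma level_takeS c i : (i < size c)%N ->
  `|level (take i.+1 c) - level (take i c)| <= 1.
Proof.
move=> ic; rewrite (take_nth (0%N, true) ic) -cats1 level_cat level_cons level_nil.
by rewrite /step; case: (nth _ _ _).2; lia.
Qed.

Lemma flipK : involutive flip.
Proof. by move=> c; rewrite /flip -map_comp map_id_in // => -[l b] _ /=; rewrite negbK. Qed.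

Definition good_init (a r : int) c :=
  level c = a /\ forall i, (i <= size c)%N -> `|level (take i c) - a| < r.

Definition good_exc (r : int) c := level c = r /\
  forall i, (0 < i < size c)%N -> 0 < level (take i c) < r.

(** Read backwards, the level at [i] becomes [r] minus the level at [size c - i], and [x -> r - x]
    preserves the open interval from 0 to [r]. *)
Lemma good_exc_rev r c : good_exc r c -> good_exc r (rev c).
Proof.
move=> [lc H]; split; first by rewrite level_rev.
move=> i; rewrite size_rev => /andP[i0 ic].
have := H (size c - i)%N; rewrite take_rev level_rev.
have := level_cat (take (size c - i) c) (drop (size c - i) c).
rewrite cat_take_drop lc => ->; lia.
Qed.

(* [c.1] stays within distance [r] of level [a] and ends there; [c.2] then makes
   the final excursion from [a] to [a + r] (if [s]) or [a - r]. *)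
Definition admissible (s : bool) (a r : int) (c : seq (nat * bool) * seq (nat * bool)) :=
  good_init a r c.1 /\ good_exc r (if s then c.2 else flip c.2).

Lemma admissible_level s a r c : admissible s a r c ->
  level c.1 = a /\ level c.2 = if s then r else - r.
Proof.
move=> [[-> _] [+ _]]; case: s => [->|H]; split=> //.
by rewrite -H level_flip opprK.
Qed.

Lemma admissible_level_inner s a r c i : 0 < r -> admissible s a r c ->
  (i < size c.2)%N -> `|level (take i c.2)| < r.
Proof.
move=> r0 [_ [_ H]] ic; have [->|i0] := posnP i; first by rewrite take0 level_nil normr0.
case: s H => H; first by have := H i; rewrite ic i0 => /(_ isT); lia.
have := H i; rewrite size_map ic i0 => /(_ isT).
by rewrite -map_take level_flip; lia.
Qed.

(** This makes the end of [c.1] the last visit of the walk to level [a]. *)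
Lemma admissible_level_neq0 s a r c i : 0 < r -> admissible s a r c ->
  (0 < i <= size c.2)%N -> level (take i c.2) != 0.
Proof.
move=> r0 adm /andP[i0]; rewrite leq_eqVlt => /predU1P[->|ic].
  by rewrite take_size (admissible_level adm).2; case: (s); lia.
case: adm => _ [_ H]; case: s H => H.
  by have := H i; rewrite ic i0 => /(_ isT); lia.
have := H i; rewrite size_map ic i0 => /(_ isT).
by rewrite -map_take level_flip; lia.
Qed.

Lemma admissible_level_lt s a r c i : 0 < r -> admissible s a r c ->
  (i < size (c.1 ++ c.2))%N -> `|level (take i (c.1 ++ c.2)) - a| < r.
Proof.
move=> r0 adm; rewrite take_cat size_cat; case: (ltnP i (size c.1)) => ic1 ic2.
  by have [[_ H] _] := adm; rewrite H // ltnW.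
rewrite level_cat (admissible_level adm).1 addrAC subrr add0r.
by apply: admissible_level_inner adm _ => //; lia.
Qed.

(** The walk determines the code: the whole word ends when the walk is first at distance [r] from
    [a], and the cut is at its last visit to [a]. *)
Lemma admissible_prefix_eq s a r c d : 0 < r ->
  admissible s a r c -> admissible s a r d ->
  c.1 ++ c.2 = take (size (c.1 ++ c.2)) (d.1 ++ d.2) -> c = d.
Proof.
move=> r0 adc add_ E.
have ltot x : admissible s a r x -> `|level (x.1 ++ x.2) - a| = r.
  move=> adx; have [l1 l2] := admissible_level adx.
  by rewrite level_cat l1 l2 addrAC subrr add0r; case: (s); lia.
have Ecd : c.1 ++ c.2 = d.1 ++ d.2.
  rewrite E take_oversize // leqNgt; apply/negP => lt.
  by have := admissible_level_lt r0 add_ lt; rewrite -E (ltot _ adc) ltxx.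
(* If the cut of [x] came before that of [y], the walk would be back at level [a] inside [x.2],
   against [admissible_level_neq0]. *)
have key x y : admissible s a r x -> admissible s a r y ->
    x.1 ++ x.2 = y.1 ++ y.2 -> (size x.1 >= size y.1)%N.
  move=> adx ady Exy; rewrite leqNgt; apply/negP => lt.
  have szE := congr1 size Exy; rewrite !size_cat in szE.
  have := congr1 (take (size y.1)) Exy.
  rewrite [RHS]take_size_cat // take_cat ltnNge (ltnW lt) /= => /(congr1 level).
  rewrite level_cat (admissible_level adx).1 (admissible_level ady).1.
  have := @admissible_level_neq0 s a r x (size y.1 - size x.1) r0 adx.
  have -> : (0 < size y.1 - size x.1 <= size x.2)%N by lia.
  by move=> /(_ isT); lia.
have szE : size c.1 = size d.1.
  by apply/eqP; rewrite eqn_leq !key.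
have E1 : c.1 = d.1.
  by have := congr1 (take (size c.1)) Ecd; rewrite take_size_cat // szE [RHS]take_size_cat.
have E2 : c.2 = d.2.
  by have := congr1 (drop (size c.1)) Ecd; rewrite drop_size_cat // szE [RHS]drop_size_cat.
by case: c d E1 E2 {adc add_ E Ecd szE} => ? ? [? ?] /= -> ->.
Qed.

(** Take for [j] the first index at level [a + r] or above, and for [i] the last index up to [j] at
    level [a] or below. The walk moves by unit steps, so both levels are attained exactly. *)
Lemma admissible_exists (a r : int) c k : 0 <= a -> 0 < r -> (k <= size c)%N ->
  a + r <= level (take k c) ->
  (forall i, (i <= k)%N -> a - r < level (take i c)) ->
  exists i j, [/\ (i <= j)%N, (j <= k)%N &
    admissible true a r (take i c, drop i (take j c))].
Proof.
move=> a0 r0 kc kr lo.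
pose P j := (j <= k)%N && (a + r <= level (take j c)).
have exP : exists j, P j by exists k; rewrite /P leqnn.
case: (ex_minnP exP) => j /andP[jk jr] jmin.
have hi i : (i < j)%N -> level (take i c) < a + r.
  move=> ij; rewrite ltNge; apply/negP => H.
  by have := jmin i; rewrite /P H andbT => /(_ ltac:(lia)); lia.
have j0 : (0 < j)%N.
  by case: j {P exP jk jmin hi} jr => //; rewrite take0 level_nil; lia.
have lj : level (take j c) = a + r.
  have := @level_takeS c j.-1; rewrite prednK //.
  by move=> /(_ ltac:(lia)); have := hi j.-1; rewrite prednK // => /(_ (leqnn _)); lia.
(* Index 0, at level 0, satisfies [Q] because [0 <= a]. *)
pose Q i := (i <= j)%N && (level (take i c) <= a).
have exQ : exists i, Q i by exists 0%N; rewrite /Q take0 level_nil.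
have Qj i : Q i -> (i <= j)%N by case/andP.
case: (ex_maxnP exQ Qj) => i /andP[ij ia] imax.
have up l : (i < l <= j)%N -> a < level (take l c).
  move=> /andP[il lj']; rewrite ltNge; apply/negP => H.
  by have := imax l; rewrite /Q lj' H => /(_ isT); lia.
have ij' : (i < j)%N.
  rewrite ltn_neqAle ij andbT; apply/eqP => E; move: ia; rewrite E lj; lia.
have li : level (take i c) = a.
  have := @level_takeS c i; move=> /(_ ltac:(lia)).
  by have := up i.+1; rewrite leqnn ij' => /(_ isT); lia.
exists i, j; split=> //; split=> /=; split.
- exact: li.
- move=> l; rewrite size_takel ?(leq_trans ij) ?(leq_trans jk) // => il.
  rewrite take_takel //; have := hi l; have := lo l; lia.
- have := level_cat (take i (take j c)) (drop i (take j c)).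
  by rewrite cat_take_drop take_takel // li lj => /addrI.
- move=> l; rewrite size_drop size_takel ?(leq_trans jk) // => /andP[l0 lij].
  have E : level (take (i + l) c) = a + level (take l (drop i (take j c))).
    rewrite takeD level_cat li; congr (_ + level _).
    by rewrite !take_drop take_takel //; lia.
  by have := up (i + l)%N; have := hi (i + l)%N; rewrite E; lia.
Qed.

End codes.

(** * Blocks of a sequence of increments *)

Section blocks.
Variable R : realFieldType.
Implicit Types (x y z : seq R) (b : seq (seq R)) (e : R).

Definition lsum x : R := \sum_(v <- x) v.

Lemma lsum_nil : lsum [::] = 0. Proof. by rewrite /lsum big_nil. Qed.
Lemma lsum_cons v x : lsum (v :: x) = v + lsum x.
Proof. by rewrite /lsum big_cons. Qed.
Lemma lsum_cat x y : lsum (x ++ y) = lsum x + lsum y.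
Proof. by rewrite /lsum big_cat. Qed.
Lemma lsum_opp x : lsum (map -%R x) = - lsum x.
Proof. by rewrite /lsum big_map sumrN. Qed.
Lemma lsum_drop i x : lsum (drop i x) = lsum x - lsum (take i x).
Proof. by rewrite -[in lsum x](cat_take_drop i x) lsum_cat addrAC subrr add0r. Qed.

(** Blocks form a prefix code: none is a proper prefix of another. For [e > 0] the empty word is not
    a block. *)
Definition is_block e y :=
  (e <= `|lsum y|) && all (fun i => `|lsum (take i y)| < e) (iota 0 (size y)).

Definition block_code y : nat * bool := (size y, 0 < lsum y).

(* [sumn (map fst c) <= size x] is needed because [reshape] truncates silently. *)
Definition matches e (c : seq (nat * bool)) x :=
  let b := reshape (map fst c) x in
  [&& (sumn (map fst c) <= size x)%N, all (is_block e) b & map block_code b == c].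

Lemma is_blockP e y i : is_block e y -> (i < size y)%N -> `|lsum (take i y)| < e.
Proof. by move=> /andP[_ /allP H] iy; apply: H; rewrite mem_iota. Qed.

Lemma is_block_opp e y : is_block e (map -%R y) = is_block e y.
Proof.
rewrite /is_block lsum_opp normrN size_map; congr (_ && _).
by apply: eq_all => i; rewrite -map_take lsum_opp normrN.
Qed.

(** For [e > 0] a block has nonzero sum, so the strict test [0 < lsum y] records its sign and is
    toggled by negation. *)
Lemma block_code_opp e y : 0 < e -> is_block e y ->
  block_code (map -%R y) = (size y, ~~ (0 < lsum y)).
Proof.
move=> e0 /andP[+ _]; rewrite /block_code size_map lsum_opp oppr_gt0 => H.
congr pair; case: (ltgtP (lsum y) 0) => // E.
by move: H; rewrite E normr0 leNgt e0.
Qed.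

Lemma reshape_flatten (T : Type) (b : seq (seq T)) (z : seq T) :
  reshape (shape b) (flatten b ++ z) = b.
Proof. by elim: b => //= y b IHb; rewrite -catA take_size_cat // drop_size_cat // IHb. Qed.

Lemma flatten_reshape_drop (T : Type) sh (x : seq T) :
  flatten (reshape sh x) ++ drop (sumn sh) x = x.
Proof.
elim: sh x => [|n sh IHsh] x; first by rewrite drop0.
by rewrite /= -catA addnC -drop_drop IHsh cat_take_drop.
Qed.

Lemma shape_block_code b : map fst (map block_code b) = shape b.
Proof. by rewrite -map_comp. Qed.

(** The boolean form suits measurability, where [c] is fixed; the factorization suits combinatorial
    arguments. *)
Lemma matchesP e c x : reflect
  (exists b z, [/\ x = flatten b ++ z, all (is_block e) b & map block_code b = c])
  (matches e c x).
Proof.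
apply: (iffP and3P) => [[sz bl /eqP cE]|[b [z [-> bl <-]]]].
  exists (reshape (map fst c) x), (drop (sumn (map fst c)) x); split=> //.
  by rewrite flatten_reshape_drop.
rewrite shape_block_code reshape_flatten bl eqxx; split=> //.
by rewrite size_cat size_flatten leq_addr.
Qed.

(** Blocks being a prefix code, a word can be cut into blocks in one way only. *)
Lemma matches_prefix e c d x : matches e c x -> matches e d x ->
  (size c <= size d)%N -> c = take (size c) d.
Proof.
move=> /matchesP[b [z [-> {x} ab <-]]] /matchesP[b' [z' [E ab' <-]]].
rewrite !size_map -map_take => sz; congr map.
elim: b b' E ab ab' sz => [|y b IHb] [|y' b'] //= E /andP[yb ab] /andP[yb' ab'].
rewrite ltnS => sz.
have key u u' v v' : is_block e u -> is_block e u' -> u ++ v = u' ++ v' -> (size u <= size u')%N.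
  move=> bu bu' Eu; rewrite leqNgt; apply/negP => lt.
  have := is_blockP bu lt; have := congr1 (take (size u')) Eu.
  rewrite take_cat lt take_size_cat // => ->.
  by case/andP: bu' => /le_lt_trans H _ /H; rewrite ltxx.
move: E; rewrite -!catA => E.
have szE : size y = size y'.
  by apply/eqP; rewrite eqn_leq (key _ _ _ _ yb yb' E) (key _ _ _ _ yb' yb (esym E)).
have Ey : y = y'.
  by have := congr1 (take (size y)) E; rewrite take_size_cat // szE [RHS]take_size_cat.
rewrite Ey; congr cons; apply: IHb => //.
by have := congr1 (drop (size y)) E; rewrite drop_size_cat // szE [RHS]drop_size_cat.
Qed.

(** This is [reversal] without the signs. It is polymorphic so that, applied to a list of indices,
    it yields the underlying permutation. *)
Definition swap_blocks (T : Type) (p : nat) (ls : seq nat) (x : seq T) :=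
  take p x ++ flatten (rev (reshape ls (drop p x))) ++ drop (p + sumn ls) x.

Definition reversal (p : nat) (ls : seq nat) x :=
  take p x ++ map -%R (flatten (rev (reshape ls (drop p x)))) ++ drop (p + sumn ls) x.

Definition code_reversal (c : seq (nat * bool) * seq (nat * bool)) :=
  reversal (sumn (map fst c.1)) (map fst c.2).

(** This is the code of the word after reversal, see [matches_reversal]; as it is an involution, the
    original code can be recovered from it. *)
Definition code_dual (c : seq (nat * bool) * seq (nat * bool)) := (c.1, rev (flip c.2)).

Lemma code_dualK : involutive code_dual.
Proof. by move=> [c1 c2]; rewrite /code_dual /= {1}/flip map_rev revK -/(flip _) flipK. Qed.

(** Reversing the order keeps the excursion an excursion, and flipping the signs moves it to the
    other side of [a]: the two exits are exchanged. *)
Lemma admissible_dual s a r c : admissible s a r c -> admissible (~~ s) a r (code_dual c).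
Proof.
move=> [ini exc]; split=> //=; case: s exc => /= /good_exc_rev.
  by rewrite /flip map_rev -/(flip _) flipK.
by [].
Qed.

Lemma code_reversalE bA bB z :
  code_reversal (map block_code bA, map block_code bB) (flatten bA ++ flatten bB ++ z)
  = flatten bA ++ flatten (rev (map (map -%R) bB)) ++ z.
Proof.
rewrite /code_reversal /reversal /= !shape_block_code -!size_flatten.
rewrite take_size_cat // drop_size_cat // reshape_flatten.
rewrite [in drop _ _]catA drop_size_cat ?size_cat // -map_rev.
by rewrite map_flatten.
Qed.

Lemma matches_catP e cA cB x : reflect
  (exists bA bB z, [/\ x = flatten bA ++ flatten bB ++ z,
     all (is_block e) bA, all (is_block e) bB,
     map block_code bA = cA & map block_code bB = cB])
  (matches e (cA ++ cB) x).
Proof.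
apply: (iffP idP) => [/matchesP[b [z [-> ab cE]]]|[bA [bB [z [-> aA aB <- <-]]]]].
  exists (take (size cA) b), (drop (size cA) b), z.
  have := ab; rewrite -{1}(cat_take_drop (size cA) b) all_cat => /andP[-> ->].
  rewrite map_take map_drop cE take_size_cat // drop_size_cat //; split=> //.
  by rewrite catA -flatten_cat cat_take_drop.
apply/matchesP; exists (bA ++ bB), z.
by rewrite flatten_cat catA all_cat aA aB map_cat.
Qed.

Lemma matches_reversal e c x : 0 < e -> matches e (c.1 ++ c.2) x ->
  matches e ((code_dual c).1 ++ (code_dual c).2) (code_reversal c x).
Proof.
move=> e0 /matches_catP[bA [bB [z [-> aA aB EA EB]]]].
have -> : c = (map block_code bA, map block_code bB) by case: c EA EB => ? ? /= -> ->.
rewrite code_reversalE; apply/matches_catP.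
exists bA, (rev (map (map -%R) bB)), z; split=> //.
  by rewrite all_rev all_map; apply: sub_all aB => y; rewrite /= is_block_opp.
rewrite map_rev /= /flip -!map_comp; congr rev; apply/eq_in_map => y yB /=.
by rewrite (@block_code_opp e) //; exact: (allP aB).
Qed.

Lemma size_flatten_rev (T : Type) (b : seq (seq T)) : size (flatten (rev b)) = size (flatten b).
Proof. by rewrite !size_flatten /shape map_rev sumn_rev. Qed.

Lemma lsum_flatten_rev b : lsum (flatten (rev b)) = lsum (flatten b).
Proof.
elim: b => // y b IHb.
by rewrite rev_cons flatten_rcons !lsum_cat IHb addrC.
Qed.

Lemma size_code_reversal c x : (sumn (map fst (c.1 ++ c.2)) <= size x)%N ->
  size (code_reversal c x) = size x.
Proof.
rewrite map_cat sumn_cat /code_reversal /reversal => sz.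
have E := flatten_reshape_drop (map fst c.2) (drop (sumn (map fst c.1)) x).
rewrite -[in RHS](cat_take_drop (sumn (map fst c.1)) x) -[in RHS]E.
by rewrite !size_cat size_map size_flatten_rev drop_drop [in RHS](addnC (sumn _)).
Qed.

Lemma map_swap_blocks (T S : Type) (f : T -> S) p ls (x : seq T) :
  map f (swap_blocks p ls x) = swap_blocks p ls (map f x).
Proof.
by rewrite /swap_blocks !map_cat map_take map_flatten map_rev map_reshape !map_drop.
Qed.

Lemma perm_swap_blocks (T : eqType) p ls (x : seq T) : perm_eq (swap_blocks p ls x) x.
Proof.
rewrite -[X in perm_eq _ X](cat_take_drop p x) perm_cat2l.
rewrite -[X in perm_eq _ X](flatten_reshape_drop ls (drop p x)) drop_drop (addnC (sumn _)) perm_cat2r.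
by apply: perm_flatten; rewrite perm_rev.
Qed.

Lemma nth_reversal p ls x i : (p + sumn ls <= size x)%N ->
  nth 0 (reversal p ls x) i =
  (if (p <= i < p + sumn ls)%N then -1 else 1) * nth 0 (swap_blocks p ls x) i.
Proof.
move=> sz; rewrite /reversal /swap_blocks !nth_cat size_map.
have sp : size (take p x) = p by rewrite size_takel //; lia.
have sf : size (flatten (rev (reshape ls (drop p x)))) = sumn ls.
  by rewrite size_flatten_rev size_flatten reshapeKl // size_drop; lia.
rewrite sp sf; case: (ltnP i p) => ip /=; first by rewrite mul1r.
rewrite ltn_subLR //; case: ifPn => il; last by rewrite mul1r.
by rewrite (nth_map 0) ?sf ?mulN1r //; lia.
Qed.

(** Proper prefixes stay below [e]; only the last increment, bounded by [eta], brings the sum to [e]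
    or past it. *)
Lemma lsum_take_block e y i eta : is_block e y -> 0 < e ->
  (forall v, v \in y -> `|v| <= eta) -> `|lsum (take i y)| <= e + eta.
Proof.
move=> yb e0 yeta; have eta0 : y != [::] -> 0 <= eta.
  by case: y yeta {yb} => // v y /(_ v (mem_head _ _)) + _; apply: le_trans.
case: y => [|v y] in yb yeta eta0 *.
  by case/andP: yb; rewrite lsum_nil normr0 => /(lt_le_trans e0); rewrite ltxx.
have {}eta0 := eta0 isT; set w := v :: y in yb yeta *.
have [iw|wi] := ltnP i (size w); first by have := is_blockP yb iw; lra.
rewrite take_oversize // -[w](cat_take_drop (size y)) lsum_cat.
have Ed : drop (size y) w = [:: nth 0 w (size y)].
  by rewrite (drop_nth 0) // drop_oversize.
rewrite Ed lsum_cons lsum_nil addr0.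
apply: (le_trans (ler_normD _ _)); apply: lerD.
  by apply/ltW/(is_blockP yb).
by apply: yeta; rewrite mem_nth.
Qed.

Lemma lsum_block e y eta : is_block e y -> 0 < e ->
  (forall v, v \in y -> `|v| <= eta) ->
  `|lsum y - e * (step (block_code y))%:~R| <= eta.
Proof.
move=> yb e0 yeta; have := lsum_take_block (size y) yb e0 yeta.
rewrite take_size /step /=; case/andP: yb => + _.
case: ltrP => s0 /=; rewrite ?mulr1 ?mulrN1.
  by rewrite gtr0_norm // => H1 H2; rewrite ger0_norm; lra.
by rewrite ler0_norm // => H1 H2; rewrite ler0_norm; lra.
Qed.

Lemma lsum_flatten_level e b eta : all (is_block e) b -> 0 < e ->
  (forall v, v \in flatten b -> `|v| <= eta) ->
  `|lsum (flatten b) - e * (level (map block_code b))%:~R| <= (size b)%:R * eta.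
Proof.
move=> + e0; elim: b => [|y b IHb] /=.
  by rewrite lsum_nil level_nil mulr0 subr0 normr0 mul0r.
move=> /andP[yb bb] beta; rewrite lsum_cat level_cons rmorphD mulrDr -addn1 natrD mulrDl mul1r.
rewrite opprD addrACA addrC.
apply: (le_trans (ler_normD _ _)); apply: lerD.
  by apply: IHb => // v vb; apply: beta; rewrite mem_cat vb orbT.
by apply: lsum_block => // v vb; apply: beta; rewrite mem_cat vb.
Qed.

(** Block [k] is the one in progress at position [j]: its started part contributes less than [e],
    and every completed block an overshoot of at most [eta]. *)
Lemma lsum_take_flatten_level e b eta j : all (is_block e) b -> 0 < e ->
  (forall v, v \in flatten b -> `|v| <= eta) -> (j < size (flatten b))%N ->
  exists2 k, (k < size b)%N &
    [/\ (size (flatten (take k b)) <= j)%N, (j < size (flatten (take k.+1 b)))%N &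
    `|lsum (take j (flatten b)) - e * (level (take k (map block_code b)))%:~R|
       <= e + (size b)%:R * eta].
Proof.
move=> + e0; elim: b j => [|y b IHb] j //= /andP[yb bb] beta.
rewrite size_cat take_cat; have [jy|yj] := ltnP j (size y) => jb.
  exists 0%N => //; rewrite /= !take0 /= level_nil mulr0 subr0 cats0; split=> //.
  have := is_blockP yb jy; have eta0 : 0 <= eta.
    case: y jy beta {yb jb} => // v y _ /(_ v); rewrite mem_head => /(_ isT).
    exact: le_trans.
  have : 0 <= (size b).+1%:R * eta by rewrite mulr_ge0.
  lra.
have bb' v : v \in flatten b -> `|v| <= eta by move=> vb; apply: beta; rewrite mem_cat vb orbT.
have yb' v : v \in y -> `|v| <= eta by move=> vb; apply: beta; rewrite mem_cat vb.
have lt : (j - size y < size (flatten b))%N by lia.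
have [k kb [k1 k2 H]] := IHb _ bb bb' lt.
exists k.+1 => //=; rewrite !size_cat; split; [lia|lia|].
rewrite lsum_cat level_cons rmorphD mulrDr -(addn1 (size b)) natrD mulrDl mul1r.
rewrite opprD addrACA [_ * eta + eta]addrC [leRHS]addrCA.
apply: (le_trans (ler_normD _ _)); apply: lerD => //.
exact: lsum_block.
Qed.

(* Compares, up to the size of a block, the block-wise reversal with the exact
   time reversal, whose first [i] increments sum to minus the last [i] ones. *)
Lemma lsum_rev_opp b beta : (forall y i, y \in b -> `|lsum (take i y)| <= beta) ->
  0 <= beta -> forall i, (i <= size (flatten b))%N ->
  `|lsum (take i (flatten (rev (map (map -%R) b)))) +
    lsum (drop (size (flatten b) - i) (flatten b))| <= 3 * beta.
Proof.
move=> + beta0; elim/last_ind: b => [|b y IHb] H i.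
  by case: i => // _; rewrite /= lsum_nil addr0 normr0 mulr_ge0.
rewrite map_rcons rev_rcons flatten_rcons /= size_cat take_cat size_map => ib.
have Hy j : `|lsum (take j y)| <= beta by apply: H; rewrite mem_rcons mem_head.
(* While [i] stays in the last block, the sum consists of three partial sums of that block, hence
   the constant 3. Beyond it, the whole block cancels with its negation and the induction hypothesis
   applies. *)
have [iy|yi] := ltnP i (size y).
  rewrite drop_cat ifN -?leqNgt; last by lia.
  rewrite -map_take lsum_opp lsum_drop.
  have := Hy i; have := Hy (size y); rewrite take_size.
  have := Hy (size (flatten b) + size y - i - size (flatten b))%N.
  rewrite !ler_norml => /andP[? ?] /andP[? ?] /andP[? ?]; apply/andP; split; lra.
have E : (size (flatten b) + size y - i = size (flatten b) - (i - size y))%N by lia.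
rewrite E drop_cat lsum_cat lsum_opp.
have Hb y' j : y' \in b -> `|lsum (take j y')| <= beta.
  by move=> yb; apply: H; rewrite mem_rcons inE yb orbT.
have := IHb Hb (i - size y)%N ltac:(lia).
case: ltnP => [lt|ge].
  rewrite lsum_cat; set u := lsum _; set v := lsum (drop _ _); set s := lsum y => K.
  by rewrite (_ : - s + u + (v + s) = u + v) //; ring.
have -> : (size (flatten b) - (i - size y) - size (flatten b) = 0)%N by lia.
rewrite drop0 drop_oversize // lsum_nil addr0.
by rewrite addrC addrA subrr add0r.
Qed.

Lemma greedy_blocks e x : 0 < e -> exists b z, [/\ x = flatten b ++ z,
  all (is_block e) b & forall i, (i <= size z)%N -> `|lsum (take i z)| < e].
Proof.
move=> e0; have [n] := ubnP (size x); elim: n x => // n IHn x; rewrite ltnS => xn.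
pose P i := (i <= size x)%N && (e <= `|lsum (take i x)|).
case: (altP (@hasP _ P (iota 0 (size x).+1))) => [[i0 _ Pi0]|/hasPn nP]; last first.
  exists [::], x; split=> // i ix; rewrite ltNge; apply/negP => H.
  by have := nP i; rewrite mem_iota add0n ltnS ix /P ix H => /(_ isT).
have exP : exists i, P i by exists i0.
case: (ex_minnP exP) => i /andP[ix iP] imin.
have i_gt0 : (0 < i)%N.
  by case: i iP {ix imin} => //; rewrite take0 lsum_nil normr0 leNgt e0.
have yb : is_block e (take i x).
  rewrite /is_block iP; apply/allP => j; rewrite mem_iota size_takel // => /andP[_ ji].
  rewrite take_takel ?(ltnW ji) // ltNge; apply/negP => H.
  by have := imin j; rewrite /P H andbT => /(_ ltac:(lia)); lia.
have [|b [z [E bb H]]] := IHn (drop i x); first by rewrite size_drop; lia.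
by exists (take i x :: b), z; split=> //=; rewrite ?yb // -catA -E cat_take_drop.
Qed.
End blocks.

Arguments block_code {R} y.

(** * Continuous paths and their discretization *)

Section paths.
Variable R : realType.
Implicit Types (w : R -> R) (t p q e : R).

(** Heine's theorem by a covering argument; only [s] is confined to the segment, so no bound has to
    be checked for the nearby point [t]. *)
Lemma segment_modulus w a b e : continuous w -> 0 < e ->
  exists2 d, 0 < d & forall s t, a <= s <= b -> `|s - t| < d -> `|w s - w t| < e.
Proof.
move=> cw e0.
have /compact_near_coveringP cov := @segment_compact R a b.
pose P (d : R) s := forall t, `|s - t| < d -> `|w s - w t| < e.
have [x xab|d /= d0 H] := cov R (0^'+) P _.
  have e20 : 0 < e / 2 by rewrite divr_gt0.
  have /cvgrPdist_lt /(_ _ e20) [r /= r0 Hr] := cw x.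
  exists (ball x (r / 2), [set d | d < r / 2]) => /=.
    split; first by apply: nbhsx_ballx; rewrite divr_gt0.
    by exists (r / 2) => //=; rewrite ?divr_gt0 // => y /=; rewrite sub0r normrN => + y0; rewrite gtr0_norm.
  move=> [s d] /= [xs dr] t st; rewrite /ball /= in xs.
  have xt : `|x - t| < r.
    rewrite -(subrKA s); apply: (le_lt_trans (ler_normD _ _)).
    have : `|s - t| < r / 2 by apply: lt_trans dr.
    lra.
  have := Hr _ xt; have := Hr s (_ : `|x - s| < r).
  move=> /(_ (lt_trans xs _)); rewrite ltr_pdivrMr // => /(_ ltac:(lra)).
  move=> H1 H2; rewrite -(subrKA (w x)); apply: (le_lt_trans (ler_normD _ _)).
  by rewrite [ltRHS](splitr e); apply: ltrD => //; rewrite distrC.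
exists (d / 2); first by rewrite divr_gt0.
move=> s t sab st; apply: (H (d / 2)) => //=; rewrite ?in_itv ?divr_gt0 //.
by rewrite sub0r normrN gtr0_norm ?divr_gt0 // ltr_pdivrMr //; lra.
Qed.

Lemma segment_gap w a b : continuous w ->
  (forall t, a <= t <= b -> 0 < w t) ->
  exists2 k, 0 < k & forall t, a <= t <= b -> k <= w t.
Proof.
move=> cw w0; have [ab|ba] := leP a b; last first.
  by exists 1 => // t tab; lra.
have [c + H] := EVT_min ab (continuous_subspaceT cw).
rewrite in_itv /= => cab; exists (w c); first exact: w0.
by move=> t tab; apply: H; rewrite in_itv.
Qed.

(** The hitting set is closed, so its infimum is attained. A value of modulus at least 1 before
    [tau w] would, by the intermediate value theorem for the modulus, give an earlier hit. *)
Lemma tauP w : continuous w -> w 0 = 0 -> hit_set w !=set0 ->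
  [/\ 0 < tau w, `|w (tau w)| = 1 & forall t, 0 <= t < tau w -> `|w t| < 1].
Proof.
move=> cw w0 h0.
have lb0 : lbound (hit_set w) 0 by move=> t [].
have hinf : has_inf (hit_set w) by split => //; exists 0.
have hcl : hit_set w (tau w).
  have : closed (hit_set w).
    have cl1 : closed ((fun t => `|w t|) @^-1` [set 1]).
      by apply: preimage_closed => [x _|]; [apply: cvg_norm; exact: cw|exact: closed_eq].
    exact: closedI (@closed_ge _ 0) cl1.
  move=> /closure_id -> B /nbhs_ballP[r /= r0 Br].
  have [t ht tr] := inf_adherent r0 hinf; exists t; split=> //; apply: Br.
  have tt : inf (hit_set w) <= t by apply: ge_inf => //; case: hinf.
  by rewrite /ball /= ler0_norm; rewrite /tau; lra.
have [t0 t1] := hcl; split=> //.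
  rewrite lt_neqAle t0 andbT; apply/eqP => E; move: t1; rewrite -E w0 normr0 => /esym/eqP.
  by rewrite oner_eq0.
move=> t /andP[t_ge0 tt]; rewrite ltNge; apply/negP => wt.
have [||c] := @IVT _ (fun x => `|w x|) 0 t 1 t_ge0.
- by apply: continuous_subspaceT => x; apply: cvg_norm; exact: cw.
- by rewrite w0 normr0 ge_min le_max ler01 wt orbT.
rewrite in_itv /= => /andP[c0 ct] wc.
have : tau w <= c by apply: ge_inf => //; exists 0.
by lra.
Qed.

(** The supremum of the zeros is a zero by closedness, and it differs from [tau w] because the path
    has modulus 1 there. *)
Lemma gtauP w : continuous w -> w 0 = 0 -> hit_set w !=set0 ->
  [/\ 0 <= gtau w, gtau w < tau w, w (gtau w) = 0 &
  forall t, gtau w < t <= tau w -> w t != 0].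
Proof.
move=> cw w0 h0; have [tau0 wtau _] := tauP cw w0 h0.
set Z := [set t | 0 <= t /\ t < tau w /\ w t = 0].
have Z0 : Z 0 by [].
have hs : has_sup Z by split; [exists 0|exists (tau w) => t [_ [/ltW]]].
have g0 : 0 <= gtau w by apply: ub_le_sup => //; case: hs.
have wg : w (gtau w) = 0.
  have cl : closed [set t | w t = 0].
    have cl0 : closed (w @^-1` [set 0]).
      by apply: preimage_closed => [x _|]; [exact: cw|exact: closed_eq].
    exact: cl0.
  have clZ : closure Z (gtau w) by apply: closure_sup; case: hs.
  have sub : Z `<=` [set t | w t = 0] by move=> t [_ [_ E]].
  by have := closureS sub clZ; have /closure_id <- := cl.
have gt : gtau w <= tau w by apply: ge_sup => [|t [_ [/ltW]]//]; exists 0.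
split=> //.
  rewrite lt_neqAle gt andbT; apply/eqP => E; move: wtau; rewrite -E wg normr0 => /esym/eqP.
  by rewrite oner_eq0.
move=> t /andP[t1 t2]; apply/eqP => wt.
have tt : t < tau w.
  rewrite lt_neqAle t2 andbT; apply/eqP => E; move: wtau; rewrite -E wt normr0 => /esym/eqP.
  by rewrite oner_eq0.
have : t <= gtau w by apply: ub_le_sup; [case: hs|split=> //; lra].
by lra.
Qed.

End paths.

(** * Sampling on a grid, and time reversal on an interval *)

Section grid.
Variable R : realType.
Implicit Types (w : R -> R) (t p q e : R) (N K n j : nat).

Definition increments N M w : seq R :=
  [seq w (i.+1%:R / N%:R) - w (i%:R / N%:R) | i <- iota 0 M].

Definition walk N (x : seq R) t : R := lsum (take (Num.truncn (t * N%:R)) x).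

Lemma size_increments N M w : size (increments N M w) = M.
Proof. by rewrite size_map size_iota. Qed.

Lemma lsum_take_increments N M w j : w 0 = 0 -> (j <= M)%N ->
  lsum (take j (increments N M w)) = w (j%:R / N%:R).
Proof.
move=> w0 jM; rewrite -map_take take_iota (minn_idPl jM).
elim: j {jM} => [|j IHj]; first by rewrite lsum_nil mul0r w0.
rewrite -[in iota _ _]addn1 iotaD map_cat lsum_cat IHj lsum_cons lsum_nil /=.
by rewrite add0n; ring.
Qed.

(* The mesh is so small that the errors made at the ends of the blocks (overshoots
   over [e], each at most [eta]) add up to at most [e]. *)
Definition fine_grid e K N w := exists2 eta : R,
  [/\ 0 < N%:R :> R, 0 <= eta, eta <= e & forall t t', 0 <= t <= K%:R -> 0 <= t' <= K%:R ->
    `|t - t'| <= N%:R^-1 -> `|w t - w t'| <= eta] &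
  forall b z, increments N (K * N) w = flatten b ++ z -> all (is_block e) b ->
    (size b)%:R * eta <= e.

(** A block displaces the path by at least [e], hence lasts at least the uniform continuity modulus
    [d] for [e]. So at most [K / d] blocks fit before time [K], however fine the mesh, and [eta] can
    be fixed before [N]. *)
Lemma near_fine w K e : continuous w -> w 0 = 0 -> 0 < e ->
  \forall N \near \oo, fine_grid e K N w.
Proof.
move=> cw w0 e0; have [d d0 Hd] := segment_modulus 0 K%:R cw e0.
(* The factor [d / K.+1%:R] compensates the number of blocks; the minimum with 1 gives
   [eta <= e]. *)
pose eta := e * Num.min 1 (d / K.+1%:R).
have m0 : 0 < Num.min 1 (d / K.+1%:R) by rewrite lt_min ltr01 divr_gt0.
have eta0 : 0 < eta by rewrite mulr_gt0.
have [d1 d10 Hd1] := segment_modulus 0 K%:R cw eta0.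
have H := near_infty_natSinv_lt (PosNum d10).
apply: near_inftyS; near=> N.
have hd1 : N.+1%:R^-1 < d1 by near: N; exact: H.
set h : R := N.+1%:R in hd1; have h0 : 0 < h by [].
exists eta; first split=> //; first exact: ltW.
- by rewrite /eta ger_pMr // ge_min lexx.
- move=> t t' tK _ tt'; apply/ltW/Hd1 => //; exact: le_lt_trans hd1.
move=> b z E bb.
(* The increments [pre] already consumed locate each block in time, which makes its sum a difference
   of two values of [w] on the grid. *)
have key b' pre : increments N.+1 (K * N.+1) w = pre ++ flatten b' ++ z ->
    all (is_block e) b' -> (size b')%:R * (d * h) <= (size (flatten b'))%:R.
  elim: b' pre => [|y b' IHb] pre /=; first by rewrite mul0r.
  move=> Ey /andP[yb bb']; rewrite size_cat natrD -add1n natrD mulrDl mul1r.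
  apply: lerD; last by apply: (IHb (pre ++ y)) => //; rewrite Ey -!catA.
  have szE := congr1 size Ey; rewrite size_increments !size_cat in szE.
  have sz1 : (size pre + size y <= K * N.+1)%N by rewrite szE leq_add2l -addnA leq_addr.
  have sz2 : (size pre <= K * N.+1)%N by rewrite szE leq_addr.
  have lsy : lsum y = w ((size pre + size y)%:R / h) - w ((size pre)%:R / h).
    rewrite /h -!(@lsum_take_increments N.+1 (K * N.+1) w) //.
    rewrite Ey [take (size pre) _]take_size_cat // -catA catA -size_cat take_size_cat //.
    by rewrite lsum_cat; ring.
  rewrite leNgt; apply/negP => lt; case/andP: yb => + _.
  rewrite leNgt lsy Hd //.
    by rewrite divr_ge0 //= ler_pdivrMr // -natrM ler_nat.
  rewrite natrD -mulrBl addrAC subrr add0r ger0_norm ?divr_ge0 //.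
  by rewrite ltr_pdivrMr.
have := key b [::] E bb; have : (size (flatten b))%:R <= K%:R * h.
  have szE := congr1 size E; rewrite size_increments size_cat in szE.
  by rewrite /h -natrM ler_nat; lia.
move=> H1 H2; have {H1 H2} : (size b)%:R * d <= K%:R.
  by have := le_trans H2 H1; rewrite mulrA ler_pM2r.
move=> H1; rewrite /eta mulrCA ler_piMr ?(ltW e0) //.
apply: (@le_trans _ _ ((size b)%:R * (d / K.+1%:R))).
  by rewrite ler_wpM2l // ge_min lexx orbT.
rewrite mulrA ler_pdivrMr // mul1r (le_trans H1) // ler_nat //.
Unshelve. all: by end_near.
Qed.

Lemma truncn_grid N t (j := Num.truncn (t * N%:R)) : 0 < N%:R :> R -> 0 <= t ->
  j%:R / N%:R <= t < j.+1%:R / N%:R.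
Proof.
move=> N0 t0; rewrite ler_pdivrMr // ltr_pdivlMr //.
by apply: truncn_itv; rewrite mulr_ge0 // ltW.
Qed.

Lemma truncn_grid_near N t (j := Num.truncn (t * N%:R)) : 0 < N%:R :> R -> 0 <= t ->
  `|t - j%:R / N%:R| <= N%:R^-1.
Proof.
move=> N0 t0; have /andP[H1 H2] := truncn_grid N0 t0.
rewrite ger0_norm ?subr_ge0 // lerBlDr; apply/ltW/(lt_le_trans H2).
by rewrite -add1n natrD mulrDl mul1r.
Qed.

Lemma truncn_grid_leq N K t : 0 < N%:R :> R -> 0 <= t <= K%:R ->
  (Num.truncn (t * N%:R) <= K * N)%N.
Proof.
move=> N0 /andP[t0 tK]; have /andP[H1 _] := truncn_grid N0 t0.
rewrite -(ler_nat R) natrM -ler_pdivrMr //; exact: le_trans tK.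
Qed.

Lemma truncn_grid_lt N t m : 0 < N%:R :> R -> 0 <= t ->
  (Num.truncn (t * N%:R) < m)%N = (t < m%:R / N%:R).
Proof.
move=> N0 t0; rewrite truncn_lt_nat ?mulr_ge0 ?(ltW N0) //.
by rewrite ltr_pdivlMr.
Qed.

(* [w] with time reversed between [p] and [q] and increments negated there, see
   [thetaE]; this form makes the continuity in [t], [p] and [q] visible. *)
Definition theta p q w t : R :=
  w (Num.min t p) + w (p + q - Num.max p (Num.min t q)) - w q +
  w (Num.max t q) - w q.

Lemma thetaE p q w t : p <= q -> theta p q w t =
  if t < p then w t else if t < q then w p - w q + w (p + q - t)
  else w t - 2 * (w q - w p).
Proof.
move=> pq; rewrite /theta; case: ltP => tp.
  have tq : t <= q by lra.
  rewrite (min_l tq) (max_l (ltW tp)) (max_r tq).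
  by rewrite (_ : p + q - p = q); ring.
case: ltP => tq; first by rewrite (max_r tp); ring.
by rewrite (max_r pq) (_ : p + q - q = p); ring.
Qed.

Lemma continuous_theta p q w : continuous w -> continuous (theta p q w).
Proof.
move=> cw t; rewrite /theta.
have cid : {for t, continuous (@id R)} by exact: cvg_id.
have ccst (a : R) : {for t, continuous (fun=> a)} by exact: cvg_cst.
have cmin a : {for t, continuous (fun t => Num.min t a)} := continuous_min cid (ccst a).
have cmax (f : R -> R) (a : R) : {for t, continuous f} -> {for t, continuous (fun t => Num.max a (f t))}.
  by move=> cf; exact: (continuous_max (ccst a) cf).
apply: cvgB; last exact: cvg_cst.
apply: cvgD; [apply: cvgB; last exact: cvg_cst; apply: cvgD|].
- by apply: continuous_comp; [exact: cmin|exact: cw].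
- apply: (@continuous_comp _ _ _ (fun t => p + q - Num.max p (Num.min t q))); last exact: cw.
  by apply: cvgB; [exact: cvg_cst|exact: cmax].
- apply: (@continuous_comp _ _ _ (fun t => Num.max t q)); last exact: cw.
  exact: (continuous_max cid (ccst q)).
Qed.

End grid.

(** * Comparison of a path with the integer walk of its blocks *)

Section matching.
Variable R : realType.
Implicit Types (w : R -> R) (t p q e eta : R) (N K n j k : nat).

Lemma increments_small K N w eta (v : R) : 0 < N%:R :> R ->
  (forall t t', 0 <= t <= K%:R -> 0 <= t' <= K%:R ->
    `|t - t'| <= N%:R^-1 -> `|w t - w t'| <= eta) ->
  v \in increments N (K * N) w -> `|v| <= eta.
Proof.
move=> N0 H /mapP[i]; rewrite mem_iota add0n /= => iK ->; apply: H.
- by rewrite divr_ge0 ?(ltW N0) //= ler_pdivrMr // -natrM ler_nat.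
- by rewrite divr_ge0 ?(ltW N0) //= ler_pdivrMr // -natrM ler_nat ltnW.
- by rewrite -mulrBl -natrB // subSnn mul1r ger0_norm // invr_ge0 ltW.
Qed.

Lemma grid_le_horizon N K m : 0 < N%:R :> R -> (m <= K * N)%N ->
  0 <= (m%:R / N%:R : R) <= K%:R.
Proof.
by move=> N0 mK; rewrite divr_ge0 ?(ltW N0) //= ler_pdivrMr // -natrM ler_nat.
Qed.

(** At the end of a block the only error is the accumulated overshoot, which a fine grid keeps below
    [e]. *)
Lemma block_end_level e K N w b z k : 0 < e -> w 0 = 0 -> fine_grid e K N w ->
  increments N (K * N) w = flatten b ++ z -> all (is_block e) b -> (k <= size b)%N ->
  `|w ((size (flatten (take k b)))%:R / N%:R) -
    e * (level (take k (map block_code b)))%:~R| <= e.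
Proof.
move=> e0 w0 [eta [N0 eta0 _ Heta] Hb] E bb kb.
have szE : (size (flatten (take k b)) <= K * N)%N.
  have := congr1 size E; rewrite size_increments size_cat.
  by rewrite -[in flatten b](cat_take_drop k b) flatten_cat size_cat; lia.
rewrite -(lsum_take_increments _ w0 szE) E -[in flatten b](cat_take_drop k b) flatten_cat.
rewrite -catA take_size_cat // -map_take.
have bk : all (is_block e) (take k b).
  by move: bb; rewrite -{1}(cat_take_drop k b) all_cat => /andP[].
apply: (le_trans (@lsum_flatten_level _ e (take k b) eta bk e0 _)).
  move=> v vb; apply: (increments_small N0 Heta); rewrite E.
  by rewrite -(cat_take_drop k b) flatten_cat !mem_cat vb.
apply: le_trans (Hb _ _ E bb).
by rewrite ler_wpM2r // ler_nat size_take_min geq_minr.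
Qed.

(** The error is at most [e] for the block in progress, [e] for the accumulated overshoots and [e]
    for rounding [t] to the grid. *)
Lemma block_inner_level e K N w b z t : 0 < e -> w 0 = 0 -> fine_grid e K N w ->
  increments N (K * N) w = flatten b ++ z -> all (is_block e) b ->
  0 <= t -> t < (size (flatten b))%:R / N%:R ->
  exists2 k, (k < size b)%N &
    [/\ (size (flatten (take k b)))%:R / N%:R <= t,
        t < (size (flatten (take k.+1 b)))%:R / N%:R &
        `|w t - e * (level (take k (map block_code b)))%:~R| <= 3 * e].
Proof.
move=> e0 w0 [eta [N0 eta0 etae Heta] Hb] E bb t0 tb.
have szE : (size (flatten b) <= K * N)%N.
  by have := congr1 size E; rewrite size_increments size_cat; lia.
rewrite -truncn_grid_lt // in tb.
have xeta v : v \in flatten b -> `|v| <= eta.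
  by move=> vb; apply: (increments_small N0 Heta); rewrite E mem_cat vb.
have [k kb [k1 k2 H]] := lsum_take_flatten_level bb e0 xeta tb.
exists k => //; split.
- have /andP[+ _] := truncn_grid N0 t0; apply: le_trans.
  by rewrite ler_pM2r ?invr_gt0 // ler_nat.
- by rewrite -truncn_grid_lt.
set j := Num.truncn _ in tb k1 k2 H.
have jK : (j <= K * N)%N by lia.
have Ej : lsum (take j (flatten b)) = w (j%:R / N%:R).
  by rewrite -(lsum_take_increments _ w0 jK) E takel_cat // ltnW.
have tK : 0 <= t <= K%:R.
  have /andP[_ H2] := truncn_grid N0 t0; rewrite t0 /=; apply/ltW/(lt_le_trans H2).
  by rewrite ler_pdivrMr // -natrM ler_nat -/j; lia.
have := Heta _ _ tK (grid_le_horizon N0 jK) (truncn_grid_near N0 t0).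
have := Hb _ _ E bb; rewrite -Ej => H1 H2.
rewrite -(subrKA (lsum (take j (flatten b)))) (le_trans (ler_normD _ _)) //.
by lra.
Qed.

Lemma scaled_level_le n (L a b : int) : (0 < n)%N -> L <= a * n%:Z + b ->
  n%:R^-1 * L%:~R <= a%:~R + b%:~R * n%:R^-1 :> R.
Proof.
move=> n0 H; rewrite -(ler_pM2l (_ : 0 < n%:R)) ?ltr0n //.
rewrite mulVKf ?pnatr_eq0 -?lt0n // mulrDr mulrCA divff ?pnatr_eq0 -?lt0n // mulr1.
have := H; rewrite -(ler_int R) rmorphD rmorphM /=; lra.
Qed.

Lemma scaled_level_ge n (L a b : int) : (0 < n)%N -> a * n%:Z + b <= L ->
  a%:~R + b%:~R * n%:R^-1 <= n%:R^-1 * L%:~R :> R.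
Proof.
move=> n0 H; have := @scaled_level_le n (- L) (- a) (- b) n0.
by move=> /(_ ltac:(lia)); rewrite !rmorphN /=; lra.
Qed.

(* With the reference level 8 the walk exits at [n - 8] or [24 - n], i.e. strictly
   inside [-n, n] with room for the approximation errors. *)
Definition radius n : int := n%:Z - 16.

(** The times [p] and [q] end the last blocks of [c.1] and [c.2]. The walk is then at 8 and at
    [n - 8] or [24 - n]; one more [e] of error gives 9 and 25. Positivity is claimed for the upper
    exit only, since a downward excursion starts above zero and may cross it. *)
Lemma matching_facts n K N w s c : (16 < n)%N -> w 0 = 0 -> fine_grid n%:R^-1 K N w ->
  admissible s 8 (radius n) c ->
  matches n%:R^-1 (c.1 ++ c.2) (increments N (K * N) w) ->
  exists p q, [/\ 0 <= p, p <= q & q <= K%:R] /\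
   [/\ forall t, 0 <= t <= q -> `|w t| < 1,
       `|w q - (if s then 1 else -1)| <= 25 * n%:R^-1,
       `|w p| <= 9 * n%:R^-1,
       s -> forall t, p <= t <= q -> 0 < w t &
       forall t, 0 <= t <= K%:R ->
         `|walk N (code_reversal c (increments N (K * N) w)) t - theta p q w t|
         <= 8 * n%:R^-1].
Proof.
move=> n16 w0 fw adm /matches_catP[bA [bB [z [E aA aB EA EB]]]].
have cE : c = (map block_code bA, map block_code bB) by case: c EA EB {adm} => ? ? /= -> ->.
have n0 : (0 < n)%N by lia.
set e : R := n%:R^-1 in fw aA aB *; have e0 : 0 < e by rewrite invr_gt0 ltr0n.
have r0 : 0 < radius n by rewrite /radius; lia.
pose b := bA ++ bB.
have bb : all (is_block e) b by rewrite all_cat aA.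
have Eb : increments N (K * N) w = flatten b ++ z by rewrite E flatten_cat catA.
have cb : map block_code b = c.1 ++ c.2 by rewrite map_cat EA EB.
have szc : size (c.1 ++ c.2) = size b by rewrite -cb size_map.
have [lA lB] := admissible_level adm.
have [eta [N0 eta0 etae Heta] Hb] := fw.
pose p : R := (size (flatten bA))%:R / N%:R.
pose q : R := (size (flatten b))%:R / N%:R.
have szE : (size (flatten b) <= K * N)%N.
  by rewrite -(size_increments N (K * N) w) Eb size_cat leq_addr.
have szA : (size (flatten bA) <= size (flatten b))%N.
  by rewrite flatten_cat size_cat leq_addr.
have p0 : 0 <= p by rewrite divr_ge0 ?(ltW N0).
have pq : p <= q by rewrite ler_pM2r ?invr_gt0 // ler_nat.
have qK : q <= K%:R by have /andP[] := grid_le_horizon N0 szE.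
have wp : `|w p - 8 * e| <= e.
  have := @block_end_level e K N w b z (size bA) e0 w0 fw Eb bb.
  rewrite take_size_cat // cb take_size_cat ?lA; last by rewrite -EA size_map.
  by rewrite [e * _]mulrC; apply; rewrite size_cat leq_addr.
have wq : `|w q - e * (8 + if s then radius n else - radius n)%:~R| <= e.
  have := block_end_level e0 w0 fw Eb bb (leqnn _).
  by rewrite take_size cb -szc take_size level_cat lA lB.
(* Before the exit the level lies between [25 - n] and [n - 9]; an error of at most [3 * e] leaves a
   margin of [6 * e]. *)
have inner t : 0 <= t < q -> `|w t| <= 1 - 6 * e.
  move=> /andP[t0 tq]; have [k kb [_ _ H]] := block_inner_level e0 w0 fw Eb bb t0 tq.
  have := @admissible_level_lt s 8 (radius n) c k r0 adm; rewrite szc -cb => /(_ kb) lk.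
  have lkB : (level (take k (map block_code b)) <= 1 * n%:Z + (- 9)) /\
      (- 1 * n%:Z + 25 <= level (take k (map block_code b))).
    by move: lk; rewrite /radius; clear; lia.
  have := scaled_level_le n0 lkB.1; have := scaled_level_ge n0 lkB.2.
  by move: H; rewrite -/e !ler_norml => /andP[? ?] ? ?; apply/andP; split; lra.
have en : e * n%:R = 1 by rewrite mulVf ?pnatr_eq0 -?lt0n.
(* With [e] at most 1/17, [1 - 9 * e] is positive and [-1 + 25 * e] is below 1. *)
have e17 : e * 17 <= 1 by rewrite -[leRHS]en ler_pM2l ?ler_nat.
have wq' : [/\ `|w q - (if s then 1 else -1)| <= 25 * e, `|w q| < 1 & s -> 0 < w q].
  move: wq; rewrite /radius; case: (s) => wq.
    have E1 : e * (8 + (n%:Z - 16))%:~R = 1 - 8 * e.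
      by rewrite !rmorphD /= !rmorphN /=; lra.
    move: wq e17 e0; rewrite E1 ler_norml; clear => /andP[? ?] ? ?.
    by split; rewrite ?ler_norml ?ltr_norml;
      [apply/andP; split; lra|apply/andP; split; lra|move=> _; lra].
  have E1 : e * (8 - (n%:Z - 16))%:~R = - 1 + 24 * e.
    by rewrite !rmorphD /= !rmorphN /= !rmorphD /= !rmorphN /=; lra.
  move: wq e17 e0; rewrite E1 ler_norml; clear => /andP[? ?] ? ?.
  by split; rewrite ?ler_norml ?ltr_norml //; apply/andP; split; lra.
exists p, q; split; [split=> //|split=> //].
- move=> t /andP[t0]; rewrite le_eqVlt => /predU1P[->|tq]; first by case: wq'.
  by apply: (le_lt_trans (inner t _)); rewrite ?t0 //; lra.
- by case: wq'.
- by move: wp; rewrite !ler_norml => /andP[? ?]; apply/andP; split; lra.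
- move=> sT t /andP[pt]; rewrite le_eqVlt => /predU1P[->|tq]; first by case: wq' => _ _; apply.
  have t0 := le_trans p0 pt.
  have [k kb [_ tk H]] := block_inner_level e0 w0 fw Eb bb t0 tq.
  (* The block in progress at [t] ends after [p], so it belongs to [bB], where the level is at least
     8; this beats the error [3 * e]. *)
  have kA : (size bA <= k)%N.
    rewrite leqNgt; apply/negP => lt; have := le_lt_trans pt tk.
    rewrite ltr_pM2r ?invr_gt0 // ltr_nat takel_cat // ltnNge.
    by rewrite -[in flatten bA](cat_take_drop k.+1 bA) flatten_cat size_cat leq_addr.
  have lk : 8 <= level (take k (map block_code b)).
    rewrite cb take_cat -EA size_map ltnNge kA /= level_cat EA lA lerDl.
    case: adm => _; rewrite sT => -[_ exc].
    have [->|k0] := posnP (k - size bA)%N; first by rewrite take0 level_nil.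
    have := exc (k - size bA)%N; rewrite k0 -EB size_map.
    have -> : (k - size bA < size bB)%N by rewrite ltn_subLR // -size_cat.
    by move=> /(_ isT) /andP[/ltW].
  have lk' : 0 * n%:Z + 8 <= level (take k (map block_code b)) by rewrite mul0r add0r.
  have := scaled_level_ge n0 lk'.
  by move: H; rewrite -/e !ler_norml => /andP[? ?] ?; lra.
move=> t /andP[t0 tK]; rewrite thetaE // /walk.
have tKK : 0 <= t <= K%:R by rewrite t0.
set j := Num.truncn (t * N%:R).
have jK : (j <= K * N)%N by exact: truncn_grid_leq.
have jt := truncn_grid_near N0 t0; rewrite -/j in jt.
have wtj : `|w t - w (j%:R / N%:R)| <= e.
  by apply: le_trans etae; apply: Heta => //; exact: grid_le_horizon.
rewrite cE E code_reversalE.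
have wpE : lsum (flatten bA) = w p.
  rewrite -(lsum_take_increments _ w0 (leq_trans szA szE)) E take_size_cat //.
have wqE : lsum (flatten bB) = w q - w p.
  rewrite -(lsum_take_increments _ w0 szE) Eb take_size_cat // flatten_cat lsum_cat wpE.
  by rewrite addrAC subrr add0r.
rewrite /p /q -!truncn_grid_lt // -/j -/p -/q flatten_cat size_cat take_cat.
have takej : (j < size (flatten bA))%N -> lsum (take j (flatten bA)) = w (j%:R / N%:R).
  by move=> jA; rewrite -(lsum_take_increments _ w0 jK) E takel_cat // ltnW.
case: ltnP => jA; first by rewrite takej // distrC; lra.
rewrite lsum_cat wpE take_cat size_flatten_rev size_flatten.
have -> : shape (map (map -%R) bB) = shape bB.
  by rewrite /shape -map_comp; apply: eq_map => y; rewrite /= size_map.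
rewrite -size_flatten ltn_subLR //; case: ltnP => jB; last first.
  have -> : lsum (flatten (rev (map (map -%R) bB)) ++
      take (j - size (flatten bA) - size (flatten bB)) z) = - (w q - w p) + (w (j%:R / N%:R) - w q).
    rewrite lsum_cat lsum_flatten_rev -map_flatten lsum_opp wqE; congr (_ + _).
    rewrite -(lsum_take_increments _ w0 jK) -(lsum_take_increments _ w0 szE) Eb.
    rewrite [in X in _ - X]take_size_cat // take_cat flatten_cat size_cat ltnNge jB /=.
    by rewrite lsum_cat subnDA; ring.
  by move: wtj; rewrite !ler_norml => /andP[? ?]; apply/andP; split; lra.
set i := (j - size (flatten bA))%N.
(* After [i] reversed increments, the first [m] increments of [bB] remain; the corresponding grid
   time is the mirror image [p + q - j / N] of the current one. *)
pose m := (size (flatten bB) - i)%N.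
have mb : (size (flatten bA) + m <= size (flatten b))%N.
  by rewrite flatten_cat size_cat leq_add2l leq_subr.
have mK := leq_trans mb szE.
have wm : lsum (take m (flatten bB)) = w ((size (flatten bA) + m)%:R / N%:R) - w p.
  rewrite -(lsum_take_increments _ w0 mK) E catA takel_cat; last first.
    by rewrite size_cat leq_add2l leq_subr.
  by rewrite takeD take_size_cat // drop_size_cat // lsum_cat wpE; ring.
have xeta v : v \in flatten bB -> `|v| <= eta.
  by move=> vb; apply: (increments_small N0 Heta); rewrite E !mem_cat vb orbT.
(* With [2 * e] as bound, [lsum_rev_opp] costs [6 * e]; rounding [t] to the grid costs at most
   another [e]. *)
have Bbnd y l : y \in bB -> `|lsum (take l y)| <= 2 * e.
  move=> yB; have := @lsum_take_block _ e y l eta (allP aB y yB) e0.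
  have yeta v : v \in y -> `|v| <= eta.
    by move=> vy; apply: xeta; apply/flattenP; exists y.
  by move=> /(_ yeta); lra.
have iB : (i <= size (flatten bB))%N by rewrite leq_subLR ltnW.
have := lsum_rev_opp Bbnd (_ : 0 <= 2 * e) iB.
move=> /(_ ltac:(by rewrite mulr_ge0 // ltW)).
rewrite lsum_drop wqE -/m wm.
have mE : (size (flatten bA) + m)%:R / N%:R = p + q - j%:R / N%:R.
  rewrite /p /q -mulrDl -mulrBl; congr (_ / _).
  rewrite -natrD flatten_cat size_cat -natrB; last by rewrite ltnW // ltn_addl.
  congr (_%:R); move: jA jB; rewrite /m /i.
  by move: (size (flatten bA)) (size (flatten bB)) (j) => u v l; clear; lia.
have jp : p <= j%:R / N%:R by rewrite ler_pM2r ?invr_gt0 // ler_nat.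
have tq : t < q by rewrite /q -truncn_grid_lt // flatten_cat size_cat.
have tp : p <= t by rewrite leNgt -truncn_grid_lt // -leqNgt.
have K1 : 0 <= p + q - t <= K%:R.
  by apply/andP; split; move: tp tq p0 qK pq; clear; lra.
have K2 := grid_le_horizon N0 mK; rewrite mE in K2.
have := Heta _ _ K1 K2; rewrite mE.
have -> : p + q - t - (p + q - j%:R / N%:R) = - (t - j%:R / N%:R) by ring.
rewrite normrN => /(_ jt); rewrite !ler_norml; move: etae e0; clear.
by move=> ? ? /andP[? ?] /andP[? ?]; apply/andP; split; lra.
Qed.

End matching.

(** * Convergence of the discrete reversal *)

Section limits.
Variable R : realType.
Implicit Types (w : R -> R) (t p q e : R) (N K n j k : nat).

Definition exits (s : bool) K w :=
  [/\ hit_set w !=set0, tau w <= K%:R & w (tau w) = if s then 1 else -1].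

Definition matching (s : bool) n N K w c :=
  admissible s 8 (radius n) c /\
  matches n%:R^-1 (c.1 ++ c.2) (increments N (K * N) w).

Lemma near_invn (k : R) : 0 < k ->
  \forall n \near \oo, (16 < n)%N /\ n%:R^-1 < k.
Proof.
move=> k0; have H := near_infty_natSinv_lt (PosNum k0).
near=> n; split; near: n; first by exists 17%N.
by apply: near_inftyS.
Unshelve. all: by end_near.
Qed.

Lemma lt1_before_hit w t : continuous w -> w 0 = 0 -> 0 <= t ->
  (forall t', 0 <= t' <= t -> `|w t'| <> 1) -> `|w t| < 1.
Proof.
move=> cw w0 t0 H; rewrite ltNge; apply/negP => wt.
have [||c] := @IVT _ (fun x => `|w x|) 0 t 1 t0.
- by apply: continuous_subspaceT => x; apply: cvg_norm; exact: cw.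
- by rewrite w0 normr0 ge_min le_max ler01 wt orbT.
by rewrite in_itv /= => tc; exact: H.
Qed.

(** Either the path leaves through the other side, and [q] precedes [tau w], or it stays inside up
    to time [K]. In both cases a positive continuous function has a positive minimum on a
    segment. *)
Lemma not_exits_gap s K w : continuous w -> w 0 = 0 -> ~ exits s K w ->
  exists2 k, 0 < k & forall q, 0 <= q <= K%:R ->
    (forall t, 0 <= t <= q -> `|w t| < 1) -> k <= `|w q - (if s then 1 else -1)|.
Proof.
(* While the modulus of the path is below 1, [f] is its distance to the boundary point of side [s],
   written without absolute value. *)
move=> cw w0 nE; pose f t := 1 - (if s then 1 else -1) * w t.
have cf : continuous f.
  by move=> t; apply: cvgB; [exact: cvg_cst|apply: cvgM; [exact: cvg_cst|exact: cw]].
have fle t : f t <= `|w t - (if s then 1 else -1)|.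
  rewrite /f; case: (s); first by rewrite mul1r distrC ler_norm.
  by rewrite mulN1r !opprK addrC ler_norm.
have f0 t : `|w t| < 1 -> 0 < f t.
  by rewrite ltr_norml /f => /andP[? ?]; case: (s); lra.
have [[h0 tK]|nh] := pselect (hit_set w !=set0 /\ tau w <= K%:R).
  have [tau0 wtau lt1] := tauP cw w0 h0.
  have [|k k0 Hk] := @segment_gap _ f 0 (tau w) cf.
    move=> t /andP[t0]; rewrite le_eqVlt => /predU1P[->|tt]; last first.
      by apply: f0; apply: lt1; rewrite t0.
    have : w (tau w) <> if s then 1 else -1 by move=> E; apply: nE.
    move: wtau; rewrite /f; case: (ltrgt0P (w (tau w))) => _; case: (s); lra.
  exists k => // q /andP[q0 qK] H; apply: le_trans (fle q); apply: Hk.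
  rewrite q0 leNgt; apply/negP => /ltW tq; have := H (tau w).
  by rewrite wtau (ltW tau0) tq ltxx => /(_ isT).
have [|k k0 Hk] := @segment_gap _ f 0 K%:R cf.
  move=> t /andP[t0 tK]; apply: f0; apply: lt1_before_hit => // t' /andP[t'0 t't] E.
  have h0 : hit_set w !=set0 by exists t'.
  apply: nh; split=> //; apply: le_trans tK; apply: le_trans t't.
  by apply: ge_inf => //; exists 0 => u [].
by exists k => // q qK _; apply: le_trans (fle q); apply: Hk.
Qed.

(** A matching code puts the path within [25 / n] of the boundary point, which contradicts the gap
    of a path that does not exit there. *)
Lemma near_matching_exits s K w : continuous w -> w 0 = 0 ->
  \forall n \near \oo, \forall N \near \oo, forall c, matching s n N K w c -> exits s K w.
Proof.
move=> cw w0; have [E|nE] := pselect (exits s K w).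
  by near=> n; near=> N.
have [k k0 Hk] := not_exits_gap cw w0 nE.
have k30 : 0 < k / 30 by rewrite divr_gt0.
near=> n.
have [n16 nk] : (16 < n)%N /\ n%:R^-1 < k / 30 by near: n; exact: near_invn.
have e0 : 0 < n%:R^-1 :> R by rewrite invr_gt0 ltr0n; apply: leq_trans n16.
near=> N => c [adm mc].
have fw : fine_grid n%:R^-1 K N w by near: N; exact: near_fine.
have [p [q [[p0 pq qK] [lt1 wq _ _ _]]]] := matching_facts n16 w0 fw adm mc.
have := Hk q; rewrite qK (le_trans p0 pq) => /(_ isT lt1) kq.
by exfalso; have := le_trans kq wq; rewrite leNgt -ltr_pdivlMl //; lra.
Unshelve. all: by end_near.
Qed.

Lemma near_walk K w t d : continuous w -> w 0 = 0 -> 0 <= t <= K%:R -> 0 < d ->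
  \forall n \near \oo, \forall N \near \oo,
    `|walk N (increments N (K * N) w) t - w t| < d.
Proof.
move=> cw w0 tK d0; near=> n.
have [n16 nd] : (16 < n)%N /\ n%:R^-1 < d by near: n; exact: near_invn.
have e0 : 0 < n%:R^-1 :> R by rewrite invr_gt0 ltr0n; apply: leq_trans n16.
near=> N.
have [eta [N0 _ etae Heta] _] : fine_grid n%:R^-1 K N w by near: N; exact: near_fine.
have jK := truncn_grid_leq N0 tK; have /andP[t0 _] := tK.
rewrite /walk lsum_take_increments // distrC.
apply: (le_lt_trans (Heta _ _ tK (grid_le_horizon N0 jK) (truncn_grid_near N0 t0))).
exact: le_lt_trans nd.
Unshelve. all: by end_near.
Qed.

(** Since [w (gtau w) = 0] and [w (tau w)] is 1 or -1, the two signs in the definition merge into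
    one formula. *)
Lemma qtrE w t : continuous w -> w 0 = 0 -> hit_set w !=set0 ->
  qtr w t = theta (gtau w) (tau w) w t.
Proof.
move=> cw w0 h0; have [_ wtau _] := tauP cw w0 h0.
have [_ /ltW gt wg _] := gtauP cw w0 h0.
rewrite thetaE // /qtr; move/asboolT : (h0) => ->; rewrite wg.
case: eqP => [->|w1].
  by case: ifP => // _; case: ifP => _; ring.
have -> : w (tau w) = -1.
  by move: wtau w1; case: (ltrgt0P (w (tau w))) => _; lra.
by case: ifP => // _; case: ifP => _; ring.
Qed.

Lemma excursion_gt0 w t : continuous w -> w 0 = 0 -> hit_set w !=set0 ->
  w (tau w) = 1 -> gtau w < t <= tau w -> 0 < w t.
Proof.
move=> cw w0 h0 w1 /andP[gt tt]; have [_ _ _ Hg] := gtauP cw w0 h0.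
rewrite ltNge; apply/negP => wt.
have [||c] := @IVT _ w t (tau w) 0 tt.
- exact: continuous_subspaceT.
- by rewrite ge_min wt w1 le_max ler01 orbT.
rewrite in_itv /= => /andP[tc ct] wc; have := Hg c.
by rewrite (lt_le_trans gt tc) ct wc eqxx => /(_ isT).
Qed.

(** The time [q] precedes [tau w] because the modulus is below 1 up to [q], and is close to it
    because [w q] is near 1. The time [p] follows the last zero because [w] is positive from [p] to
    [q], and is close to it because [w p] is near 0. *)
Lemma endpoints_close K w d : continuous w -> w 0 = 0 -> exits true K w -> 0 < d ->
  exists2 k, 0 < k & forall p q e, e < k -> 0 <= p <= q ->
    (forall t, 0 <= t <= q -> `|w t| < 1) -> `|w q - 1| <= 25 * e ->
    `|w p| <= 9 * e -> (forall t, p <= t <= q -> 0 < w t) ->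
  `|p - gtau w| < d /\ `|q - tau w| < d.
Proof.
move=> cw w0 [h0 tK w1] d0; have [tau0 _ lt1] := tauP cw w0 h0.
have [g0 gt wg _] := gtauP cw w0 h0.
(* The cap at half the excursion gives [gtau w < tau w - d' < q]; the positivity of [w] from [p] to
   [q] then rules out [p <= gtau w]. *)
pose d' := Num.min d ((tau w - gtau w) / 2).
have d'0 : 0 < d' by rewrite lt_min d0 divr_gt0 // subr_gt0.
have d'd : d' <= d by rewrite ge_min lexx.
have d'g : d' <= (tau w - gtau w) / 2 by rewrite ge_min lexx orbT.
have cf : continuous (fun t => 1 - w t).
  by move=> t; apply: cvgB; [exact: cvg_cst|exact: cw].
have [|k1 k10 H1] := @segment_gap _ _ 0 (tau w - d') cf.
  move=> t /andP[t0 tt]; have := lt1 t; rewrite t0 ltr_norml /= => /(_ ltac:(lra)).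
  by case/andP => _; rewrite subr_gt0.
have [|k2 k20 H2] := @segment_gap _ _ (gtau w + d') (tau w) cw.
  by move=> t /andP[t0 tt]; apply: excursion_gt0 => //; rewrite tt andbT; lra.
exists (Num.min k1 k2 / 30); first by rewrite divr_gt0 // lt_min k10.
move=> p q e; rewrite ltr_pdivlMr // lt_min => /andP[e1 e2] /andP[p0 pq] lt1q wq wp pos.
have qt : q < tau w.
  rewrite ltNge; apply/negP => tq; have := lt1q (tau w).
  by rewrite tq (ltW tau0) w1 normr1 ltxx => /(_ isT).
have tq : tau w - d' < q.
  rewrite ltNge; apply/negP => H; have := H1 q; rewrite H (le_trans p0 pq) => /(_ isT).
  by move: wq; rewrite ler_norml => /andP[? ?] ?; lra.
have gp : gtau w < p.
  rewrite ltNge; apply/negP => pg; have := pos (gtau w).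
  by rewrite pg wg ltxx => /(_ ltac:(lra)).
have pg : p < gtau w + d'.
  rewrite ltNge; apply/negP => H; have := H2 p; rewrite H => /(_ ltac:(lra)).
  by move: wp; rewrite ler_norml => /andP[? ?] ?; lra.
by split; rewrite ltr_norml; apply/andP; split; lra.
Qed.

Lemma max_close (a b x y m : R) : `|a - b| < m -> `|x - y| < m ->
  `|Num.max a x - Num.max b y| < m.
Proof.
rewrite !ltr_norml => /andP[? ?] /andP[? ?].
by case: (leP a x) => ?; case: (leP b y) => ?; apply/andP; split; lra.
Qed.

Lemma min_close (a b x y m : R) : `|a - b| < m -> `|x - y| < m ->
  `|Num.min a x - Num.min b y| < m.
Proof.
rewrite !ltr_norml => /andP[? ?] /andP[? ?].
by case: (leP a x) => ?; case: (leP b y) => ?; apply/andP; split; lra.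
Qed.

(** Five values of [w] enter [theta], counting [w q] twice. The time argument [p + q - max]
    accumulates three errors below [m / 4], the others fewer. *)
Lemma theta_close w p q p' q' t b d m : 0 <= p <= q -> q <= b -> 0 <= p' <= q' -> q' <= b ->
  0 <= t <= b ->
  (forall u v, 0 <= u <= b -> `|u - v| < m -> `|w u - w v| < d) ->
  `|p - p'| < m / 4 -> `|q - q'| < m / 4 ->
  `|theta p q w t - theta p' q' w t| < 5 * d.
Proof.
move=> /andP[p0 pq] qb /andP[p'0 pq'] qb' /andP[t0 tb] Hw.
move=> pp qq; rewrite /theta.
have tt : `|t - t| < m / 4 by rewrite subrr normr0; apply: le_lt_trans pp.
have minq := min_close tt qq.
have maxq := max_close pp minq.
have m0 : 0 < m / 4 by apply: le_lt_trans tt.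
have mm : m / 4 <= m by lra.
have A1 : `|w (Num.min t p) - w (Num.min t p')| < d.
  apply: Hw; last exact: lt_le_trans (min_close tt pp) mm.
  by rewrite le_min t0 p0 ge_min tb.
have A2 : `|w (p + q - Num.max p (Num.min t q)) - w (p' + q' - Num.max p' (Num.min t q'))| < d.
  apply: Hw.
    have : p <= Num.max p (Num.min t q) <= q.
      by rewrite le_max lexx ge_max pq ge_min lexx orbT.
    by move=> /andP[? ?]; apply/andP; split; lra.
  move: pp qq maxq; rewrite !ltr_norml => /andP[? ?] /andP[? ?] /andP[? ?].
  by apply/andP; split; lra.
have A3 : `|w q - w q'| < d.
  by apply: Hw; [rewrite (le_trans p0 pq)|exact: lt_le_trans qq mm].
have A4 : `|w (Num.max t q) - w (Num.max t q')| < d.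
  apply: Hw; last exact: lt_le_trans (max_close tt qq) mm.
  by rewrite le_max t0 ge_max tb.
move: A1 A2 A3 A4; rewrite !ltr_norml; move=> /andP[? ?] /andP[? ?] /andP[? ?] /andP[? ?].
by apply/andP; split; lra.
Qed.

Lemma near_walk_reversal K w t d : continuous w -> w 0 = 0 -> exits true K w ->
  0 <= t <= K%:R -> 0 < d ->
  \forall n \near \oo, \forall N \near \oo, forall c, matching true n N K w c ->
    `|walk N (code_reversal c (increments N (K * N) w)) t - qtr w t| < d.
Proof.
move=> cw w0 ex tK d0; have [h0 tauK w1] := ex.
(* [theta_close] will cost [5 * (d / 10)], and the discretization [8 / n] with [1 / n < d / 20]; the
   sum is below [d]. *)
have d6 : 0 < d / 10 by rewrite divr_gt0.
have [m m0 Hm] := segment_modulus 0 K%:R cw d6.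
have m4 : 0 < m / 4 by rewrite divr_gt0.
have [k k0 Hk] := endpoints_close cw w0 ex m4.
have kd0 : 0 < Num.min k (d / 20) by rewrite lt_min k0 divr_gt0.
near=> n.
have [n16 nk] : (16 < n)%N /\ n%:R^-1 < Num.min k (d / 20) by near: n; exact: near_invn.
have e0 : 0 < n%:R^-1 :> R by rewrite invr_gt0 ltr0n; apply: leq_trans n16.
near=> N => c [adm mc].
have fw : fine_grid n%:R^-1 K N w by near: N; exact: near_fine.
have [p [q [[p0 pq qK] [lt1 wq wp pos Hwalk]]]] := matching_facts n16 w0 fw adm mc.
move: nk; rewrite lt_min => /andP[nk nd].
have pq0 : 0 <= p <= q by rewrite p0.
have [pg qt] := Hk p q _ nk pq0 lt1 wq wp (pos isT).
have [g0 /ltW gt _ _] := gtauP cw w0 h0.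
have gt0 : 0 <= gtau w <= tau w by rewrite g0.
have := theta_close pq0 qK gt0 tauK tK Hm pg qt.
rewrite qtrE //; have := Hwalk t tK.
set a := walk _ _ _; set b := theta _ _ _ _; set b' := theta _ _ _ _ => H1 H2.
rewrite -(subrKA b) (le_lt_trans (ler_normD _ _)) //.
by move: H1 H2 nd; lra.
Unshelve. all: by end_near.
Qed.

(** Cut the increments greedily. By time [tau w] the walk has reached [n - 8], and it has stayed
    above [24 - n] because the path is bounded away from -1 up to [tau w]; [admissible_exists] then
    extracts the code. *)
Lemma near_matching_exists K w : continuous w -> w 0 = 0 -> exits true K w ->
  \forall n \near \oo, \forall N \near \oo, exists c, matching true n N K w c.
Proof.
move=> cw w0 [h0 tauK w1]; have [tau0 _ lt1] := tauP cw w0 h0.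
have cf : continuous (fun t => 1 + w t).
  by move=> t; apply: cvgD; [exact: cvg_cst|exact: cw].
have [|k k0 Hk] := @segment_gap _ _ 0 (tau w) cf.
  move=> t /andP[t0]; rewrite le_eqVlt => /predU1P[->|tt]; first by rewrite w1; lra.
  by have := lt1 t; rewrite t0 tt ltr_norml => /(_ isT) /andP[? _]; lra.
have k30 : 0 < k / 30 by rewrite divr_gt0.
near=> n.
have [n16 nk] : (16 < n)%N /\ n%:R^-1 < k / 30 by near: n; exact: near_invn.
have n0 : (0 < n)%N by apply: leq_trans n16.
set e : R := n%:R^-1 in nk.
have e0 : 0 < e by rewrite invr_gt0 ltr0n.
have en : e * n%:R = 1 by rewrite mulVf ?pnatr_eq0 -?lt0n.
near=> N.
have fw : fine_grid e K N w by near: N; exact: near_fine.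
have [eta [N0 eta0 etae Heta] Hb] := fw.
have [b [z [E bb Hz]]] := greedy_blocks (increments N (K * N) w) e0.
have tauK' : 0 <= tau w <= K%:R by rewrite (ltW tau0).
set c := map (@block_code R) b.
(* [k'] counts the blocks completed by [tau w]. If [tau w] falls after the last block, the
   incomplete remainder [z] contributes less than [e]. *)
have [k' [kb kt Hlev]] : exists k', [/\ (k' <= size b)%N,
    (size (flatten (take k' b)))%:R / N%:R <= tau w & `|1 - e * (level (take k' c))%:~R| <= 3 * e].
  have [tb|bt] := ltP (tau w) ((size (flatten b))%:R / N%:R).
    have [k' kb [k1 _ H]] := block_inner_level e0 w0 fw E bb (ltW tau0) tb.
    by exists k'; split; [exact: ltnW|by []|rewrite -[X in X - _]w1].
  exists (size b); split=> //; first by rewrite take_size.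
  have lev := block_end_level e0 w0 fw E bb (leqnn _); rewrite take_size in lev.
  set j := Num.truncn (tau w * N%:R).
  have jK : (j <= K * N)%N by exact: truncn_grid_leq.
  have bj : (size (flatten b) <= j)%N by rewrite leqNgt truncn_grid_lt ?(ltW tau0) // -leNgt.
  have szE : (size (flatten b) <= K * N)%N by exact: leq_trans jK.
  have := Heta _ _ tauK' (grid_le_horizon N0 jK) (truncn_grid_near N0 (ltW tau0)).
  rewrite w1.
  have zj : (j - size (flatten b) <= size z)%N.
    by rewrite leq_subLR -size_cat -E size_increments.
  have := Hz _ zj.
  have -> : lsum (take (j - size (flatten b)) z) =
      w (j%:R / N%:R) - w ((size (flatten b))%:R / N%:R).
    rewrite -(lsum_take_increments _ w0 jK) -(lsum_take_increments _ w0 szE) E.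
    rewrite [in X in _ - X]take_size_cat // take_cat ltnNge bj /= lsum_cat.
    by rewrite addrAC subrr add0r.
  move: lev etae; clear.
  rewrite -/c !ler_norml !ltr_norml => /andP[? ?] ? /andP[? ?] /andP[? ?].
  by apply/andP; split; lra.
have szc : size c = size b by rewrite size_map.
have hi : 8 + radius n <= level (take k' c).
  rewrite leNgt; apply/negP => lt.
  have le : level (take k' c) <= 1 * n%:Z + (- 9) by move: lt; rewrite /radius; clear; lia.
  have := scaled_level_le R n0 le; rewrite -/e.
  by move: Hlev; rewrite ler_norml => /andP[? ?] ?; lra.
have lo i : (i <= k')%N -> 8 - radius n < level (take i c).
  move=> ik; rewrite ltNge; apply/negP => lt.
  have le : level (take i c) <= -1 * n%:Z + 24 by move: lt; rewrite /radius; clear; lia.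
  have := scaled_level_le R n0 le; rewrite -/e.
  have := block_end_level e0 w0 fw E bb (leq_trans ik kb); rewrite -/c.
  set T := _ / _; have T0 : 0 <= T <= tau w.
    rewrite divr_ge0 ?(ltW N0) //=; apply: le_trans kt; rewrite ler_pM2r ?invr_gt0 //.
    rewrite ler_nat -[in take k' b](cat_take_drop i (take k' b)) take_takel //.
    by rewrite flatten_cat size_cat leq_addr.
  by have := Hk T T0; rewrite ler_norml => ? /andP[? ?] ?; lra.
have r0 : 0 < radius n by move: n16; rewrite /radius; clear; lia.
have kc : (k' <= size c)%N by rewrite szc.
have a0 : 0 <= 8 :> int by [].
have [i [j [ij jk adm]]] := admissible_exists a0 r0 kc hi lo.
exists (take i c, drop i (take j c)); split=> //=.
have -> : take i c ++ drop i (take j c) = take j c.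
  by rewrite -{1}(take_takel c ij) cat_take_drop.
apply/matchesP; exists (take j b), (flatten (drop j b) ++ z).
rewrite E catA -flatten_cat cat_take_drop map_take; split=> //.
by move: bb; rewrite -{1}(cat_take_drop j b) all_cat => /andP[].
Unshelve. all: by end_near.
Qed.

End limits.

(** * Laws *)

Section set_fatou.
Context d (T : measurableType d) (R : realType).
Implicit Types (A B : set T) (F : nat -> set T).

Lemma near_setE F : [set om | \forall n \near \oo, F n om] =
  \bigcup_n \bigcap_(m in [set m | (n <= m)%N]) F m.
Proof.
apply/seteqP; split=> [om [n _ Hn]|om [n _ Hn]]; exists n => //.
Qed.

Lemma measurable_near F : (forall n, measurable (F n)) ->
  measurable [set om | \forall n \near \oo, F n om].
Proof.
move=> mF; rewrite near_setE; apply: bigcupT_measurable => n.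
exact: bigcap_measurableType.
Qed.

Lemma measurable_near2 (F : nat -> nat -> set T) : (forall n N, measurable (F n N)) ->
  measurable [set om | \forall n \near \oo, \forall N \near \oo, F n N om].
Proof.
by move=> mF; apply: (@measurable_near (fun n => [set om | \forall N \near \oo, F n N om])) => n;
  exact: measurable_near.
Qed.

Variable P : probability T R.

(** Fatou's lemma for sets, by continuity from below along the increasing intersections [G n]. *)
Lemma near_lt_measure F A (c : \bar R) : measurable A -> (forall n, measurable (F n)) ->
  A `<=` [set om | \forall n \near \oo, F n om] -> (c < P A)%E ->
  \forall n \near \oo, (c < P (F n))%E.
Proof.
move=> mA mF AF cA; pose G n := \bigcap_(m in [set m | (n <= m)%N]) F m.
have mG n : measurable (G n) by exact: bigcap_measurableType.
have mUG : measurable (\bigcup_n G n) by exact: bigcupT_measurable.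
have ndG : nondecreasing_seq G.
  move=> m n mn; apply/subsetPset => om H k /= nk; apply: H => /=; exact: leq_trans nk.
have cvG := nondecreasing_cvg_mu mG mUG ndG.
have cUG : (c < P (\bigcup_n G n))%E.
  by apply: lt_le_trans cA _; apply: le_measure; rewrite ?inE // /G -near_setE.
have : \forall n \near \oo, (c < P (G n))%E.
  apply: (cvG R P [set y | (c < y)%E]); apply: open_nbhs_nbhs; split => //.
  exact: open_ereal_gt_ereal.
apply: filterS => n cG; apply: lt_le_trans cG _.
apply: le_measure; rewrite ?inE //; move=> om; apply => /=; exact: leqnn.
Qed.

Lemma near2_lt_measure (F : nat -> nat -> set T) A (c : \bar R) :
  measurable A -> (forall n N, measurable (F n N)) ->
  A `<=` [set om | \forall n \near \oo, \forall N \near \oo, F n N om] -> (c < P A)%E ->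
  \forall n \near \oo, \forall N \near \oo, (c < P (F n N))%E.
Proof.
move=> mA mF AF cA.
have := @near_lt_measure (fun n => [set om | \forall N \near \oo, F n N om]) A c mA.
move=> /(_ (fun n => measurable_near (mF n)) AF cA); apply: filterS => n.
by apply: near_lt_measure => //; exact: measurable_near.
Qed.

(** Fatou applies to [F] and to the complements of [F']. If [P B < P A], a real [c] strictly between
    them separates [P (F n N)] from [P (F' n N)] the wrong way for suitable [n] and [N]. *)
Lemma le_measure_near2 (F F' : nat -> nat -> set T) A B :
  measurable A -> measurable B ->
  (forall n N, measurable (F n N)) -> (forall n N, measurable (F' n N)) ->
  A `<=` [set om | \forall n \near \oo, \forall N \near \oo, F n N om] ->
  ~` B `<=` [set om | \forall n \near \oo, \forall N \near \oo, ~ F' n N om] ->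
  (\forall n \near \oo, \forall N \near \oo, (P (F n N) <= P (F' n N))%E) ->
  (P A <= P B)%E.
Proof.
move=> mA mB mF mF' AF BF FF'; rewrite leNgt; apply/negP => BA.
have fA := fin_num_measure P A mA; have fB := fin_num_measure P B mB.
have [c cB cA] : exists2 c : R, (P B < c%:E)%E & (c%:E < P A)%E.
  move: BA; rewrite -(fineK fA) -(fineK fB) lte_fin => BA.
  by exists ((fine (P A) + fine (P B)) / 2); rewrite lte_fin; lra.
have H1 := near2_lt_measure mA mF AF cA.
have cB' : ((1 - c)%:E < P (~` B))%E.
  by rewrite probability_setC // -(fineK fB) -EFinB lte_fin ltrD2l ltrN2 -lte_fin fineK.
have H2 := near2_lt_measure (measurableC mB) (fun n N => measurableC (mF' n N)) BF cB'.
have [n [[Hn1 Hn2] Hn3]] := filter_ex (filterI (filterI H1 H2) FF').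
have [N [[HF HF'] HN]] := filter_ex (filterI (filterI Hn1 Hn2) Hn3).
have := lt_le_trans HF HN.
have fF := fin_num_measure P _ (mF' n N).
move: HF'; rewrite probability_setC // -(fineK fF) -EFinB !lte_fin; lra.
Qed.

Lemma le_measure_near (F F' : nat -> set T) A B :
  measurable A -> measurable B ->
  (forall n, measurable (F n)) -> (forall n, measurable (F' n)) ->
  A `<=` [set om | \forall n \near \oo, F n om] ->
  ~` B `<=` [set om | \forall n \near \oo, ~ F' n om] ->
  (\forall n \near \oo, (P (F n) <= P (F' n))%E) -> (P A <= P B)%E.
Proof.
move=> mA mB mF mF' AF BF FF'.
apply: (@le_measure_near2 (fun n _ => F n) (fun n _ => F' n)) => //.
- by move=> om /AF; apply: filterS => n Fn; apply: nearW.
- by move=> om /BF; apply: filterS => n Fn; apply: nearW.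
- by apply: filterS FF' => n FF'n; apply: nearW.
Qed.

End set_fatou.

Lemma normal_probN (R : realType) (s : R) (B : set R) : s != 0 -> measurable B ->
  normal_prob 0 s (-%R @^-1` B) = normal_prob 0 s B.
Proof.
move=> s0 mB; rewrite /normal_prob.
have pdfN x : normal_pdf 0 s (- x) = normal_pdf 0 s x.
  by rewrite normal_pdfE // /normal_fun !subr0 sqrrN.
have mf : measurable_fun setT (EFin \o normal_pdf 0 s).
  by apply/measurable_EFinP; exact: measurable_normal_pdf.
transitivity (\int[pushforward lebesgue_measure (-%R : _ -> measurableTypeR R)]_(y in B)
    (EFin \o normal_pdf 0 s) y)%E; last first.
  by apply: eq_measure_integral => A mA _; exact: lebesgue_measureN.
rewrite ge0_integral_pushforward //; last 2 first.
- exact: measurable_funTS.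
- by move=> x _; rewrite lee_fin normal_pdf_ge0.
by apply: eq_integral => x _ /=; rewrite pdfN.
Qed.

(** * Laws of signed permutations of independent symmetric coordinates *)

Section tuple_law.
Context d (T : measurableType d) (R : realType) (P : probability T R) (M : nat).
Implicit Types (X Y : T -> M.-tuple R).

(** Rectangles are stable under intersection and generate the product sigma-algebra. *)
Lemma tuple_law_unique X Y : measurable_fun setT X -> measurable_fun setT Y ->
  (forall B : 'I_M -> set R, (forall i, measurable (B i)) ->
    P [set om | forall i, B i (tnth (X om) i)] = P [set om | forall i, B i (tnth (Y om) i)]) ->
  forall D, measurable D -> P (X @^-1` D) = P (Y @^-1` D).
Proof.
move=> mX mY XY D mD.
pose G : set (set (M.-tuple R)) := [set D | exists2 B : 'I_M -> set R,
  (forall i, measurable (B i)) & D = [set x | forall i, B i (tnth x i)]].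
have Gm : G `<=` measurable.
  move=> _ [B mB ->].
  have -> : [set x : M.-tuple R | forall i, B i (tnth x i)] =
      \bigcap_(i in [set: 'I_M]) ((fun x => tnth x i) @^-1` B i).
    by apply/seteqP; split=> [x Hx i _|x Hx i]; [exact: Hx|exact: (Hx i)].
  apply: fin_bigcap_measurable; first exact: finite_finset.
  by move=> i _; rewrite -[X in measurable X]setTI; exact: measurable_tnth.
have GT : G setT by exists (fun=> setT) => //; apply/seteqP.
have GI : setI_closed G.
  move=> _ _ [B mB ->] [C mC ->]; exists (fun i => B i `&` C i).
    by move=> i; exact: measurableI.
  by apply/seteqP; split=> [x [Hx Kx] i|x H]; [split|split=> i; case: (H i)].
have sG : measurable `<=` <<s G >>.
  apply: smallest_sub; first exact: smallest_sigma_algebra.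
  rewrite -bigcup_seq; apply: bigcup_sub => i _ _ [B mB <-].
  apply: sub_sigma_algebra; exists (fun j => if j == i then B else setT).
    by move=> j; case: ifP.
  apply/seteqP; split=> [x [_ Bx] j|x H]; first by case: eqP => [->|].
  by split=> //; have := H i; rewrite eqxx.
have := @g_sigma_algebra_measure_unique _ R _ G Gm (fun=> setT) (fun=> GT) _
  (pushforward P X) (pushforward P Y) GI _ _ D (sG _ mD).
apply.
- by rewrite bigcup_const //; exists 0%N.
- by move=> _ [B mB ->]; exact: XY.
- by move=> _; rewrite /= /pushforward preimage_setT probability_setT ltry.
Qed.

Lemma signed_perm_law (gam : probability (measurableTypeR R) R) X Y
    (s : 'I_M -> 'I_M) (eps : 'I_M -> bool) :
  measurable_fun setT X -> measurable_fun setT Y ->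
  (forall B : set R, measurable B -> gam (-%R @^-1` B) = gam B) ->
  (forall B : 'I_M -> set R, (forall i, measurable (B i)) ->
    P [set om | forall i, B i (tnth (X om) i)] = (\prod_(i < M) gam (B i))%E) ->
  injective s ->
  (forall om i, tnth (Y om) i = (-1) ^+ eps i * tnth (X om) (s i)) ->
  forall D, measurable D -> P (X @^-1` D) = P (Y @^-1` D).
Proof.
move=> mX mY symg XB sinj YX; apply: tuple_law_unique => // B mB.
rewrite XB //; pose t := invF sinj.
(* A condition on coordinate [i] of [Y] is turned into one on coordinate [s i] of [X]; [t] inverts
   [s]. *)
pose C j := (fun x : R => (-1) ^+ eps (t j) * x) @^-1` B (t j).
have mC j : measurable (C j).
  by rewrite -[X in measurable X]setTI; apply: mulrl_measurable.
have -> : [set om | forall i, B i (tnth (Y om) i)] =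
    [set om | forall i, C i (tnth (X om) i)].
  apply/seteqP; split=> om H i; rewrite /C /=.
    by have := H (t i); rewrite YX /t f_invF.
  by have := H (s i); rewrite /C /= /t invF_f YX.
rewrite XB // [RHS](reindex_inj sinj); apply: eq_bigr => i _.
rewrite /C /t invF_f; case: (eps i).
  rewrite -symg //; congr (gam _); apply/seteqP; split=> x; rewrite /= expr1 mulN1r //.
by congr (gam _); apply/seteqP; split=> x; rewrite /= expr0 mul1r.
Qed.

End tuple_law.

Lemma lsum_takeS (R : realFieldType) (x : seq R) m :
  lsum (take m.+1 x) = lsum (take m x) + nth 0 x m.
Proof.
have [xm|mx] := leqP (size x) m; last first.
  by rewrite (take_nth 0 mx) -cats1 lsum_cat lsum_cons lsum_nil addr0.
by rewrite !take_oversize ?(leqW xm) // nth_default // addr0.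
Qed.

Lemma lsum_take_drop (R : realFieldType) (x : seq R) s k :
  lsum (take k (drop s x)) = lsum (take (s + k) x) - lsum (take s x).
Proof. by rewrite takeD lsum_cat addrAC subrr add0r. Qed.

(** * Measurability of the discrete events *)

Section measurable_sets.
Context d (T : measurableType d) (R : realType).
Implicit Types (g : T -> R) (a : R).

Lemma measurable_ltr_set g a : measurable_fun setT g -> measurable [set x | g x < a].
Proof.
move=> mg; rewrite (_ : [set _ | _] = setT `&` g @^-1` `]-oo, a[).
  by apply: mg => //; exact: measurable_itv.
by apply/seteqP; split=> x; rewrite /= in_itv //= => -[].
Qed.

Lemma measurable_gtr_set g a : measurable_fun setT g -> measurable [set x | a < g x].
Proof.
move=> mg; rewrite (_ : [set _ | _] = setT `&` g @^-1` `]a, +oo[).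
  by apply: mg => //; exact: measurable_itv.
by apply/seteqP; split=> x; rewrite /= in_itv /= andbT // => -[].
Qed.

Lemma measurable_ger_set g a : measurable_fun setT g -> measurable [set x | a <= g x].
Proof.
move=> mg; rewrite (_ : [set _ | _] = ~` [set x | g x < a]).
  exact/measurableC/measurable_ltr_set.
by apply/seteqP; split=> x /=; rewrite leNgt => /negP.
Qed.

Lemma measurable_all_set (I : Type) (s : seq I) (q : I -> T -> bool) :
  (forall i, measurable [set x | q i x]) -> measurable [set x | all (q^~ x) s].
Proof.
move=> mq; elim: s => [|i s IHs] /=; first by rewrite (_ : [set _ | _] = setT) //; apply/seteqP.
rewrite (_ : [set _ | _] = [set x | q i x] `&` [set x | all (q^~ x) s]).
  exact: measurableI.
by apply/seteqP; split=> x /= => [/andP|H]; [|apply/andP].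
Qed.

Lemma measurable_cond (p : Prop) (A : set T) : measurable A -> measurable [set x | p /\ A x].
Proof.
move=> mA; have [Hp|np] := pselect p.
  by rewrite (_ : [set _ | _] = A) //; apply/seteqP; split=> x // [].
by rewrite (_ : [set _ | _] = set0) // -subset0 => x [].
Qed.

End measurable_sets.

Section tuple_measurable.
Variables (R : realType) (M : nat).
Implicit Types (x : M.-tuple R) (c : seq (nat * bool)) (e : R).

Lemma measurable_nth_tuple j : measurable_fun setT (fun x => nth 0 x j).
Proof.
have [jM|Mj] := ltnP j M.
  rewrite (_ : (fun _ => _) = (fun x => tnth x (Ordinal jM))); first exact: measurable_tnth.
  by apply/funext => x; rewrite (tnth_nth 0).
rewrite (_ : (fun _ => _) = cst 0); first exact: measurable_cst.
by apply/funext => x; rewrite nth_default // size_tuple.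
Qed.

Lemma measurable_lsum_take m : measurable_fun setT (fun x => lsum (take m x)).
Proof.
elim: m => [|m IHm].
  rewrite (_ : (fun _ => _) = cst 0); first exact: measurable_cst.
  by apply/funext => x; rewrite take0 lsum_nil.
rewrite (_ : (fun _ => _) = (fun x => lsum (take m x)) \+ (fun x => nth 0 x m)).
  by apply: measurable_funD => //; exact: measurable_nth_tuple.
by apply/funext => x; exact: lsum_takeS.
Qed.

Lemma measurable_walk N t : measurable_fun setT (fun x => walk N x t).
Proof. exact: measurable_lsum_take. Qed.

Lemma measurable_lsum_piece i l s :
  measurable_fun setT (fun x => lsum (take i (take l (drop s x)))).
Proof.
rewrite (_ : (fun _ => _) = (fun x => lsum (take (s + minn i l) x)) \- (fun x => lsum (take s x))).
  by apply: measurable_funB; exact: measurable_lsum_take.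
by apply/funext => x; rewrite -take_min lsum_take_drop.
Qed.

Lemma measurable_is_block e l s : measurable [set x : M.-tuple R | is_block e (take l (drop s x))].
Proof.
rewrite (_ : [set _ | _] = [set x : M.-tuple R | e <= `|lsum (take l (take l (drop s x)))|] `&`
    [set x : M.-tuple R | all (fun i => `|lsum (take i (take l (drop s x)))| < e) (iota 0 (minn l (M - s)))]).
  apply: measurableI.
    by apply: measurable_ger_set; apply: measurableT_comp => //; exact: measurable_lsum_piece.
  apply: (@measurable_all_set _ _ _ _ (fun i x => `|lsum (take i (take l (drop s x)))| < e)) => i.
  by apply: measurable_ltr_set; apply: measurableT_comp => //; exact: measurable_lsum_piece.
apply/seteqP; split=> x; rewrite /= /is_block size_take_min size_drop size_tuple (take_takel _ (leqnn l)).
  by move/andP.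
by move=> [? ?]; apply/andP.
Qed.

Lemma measurable_block_code l s k : measurable [set x : M.-tuple R | block_code (take l (drop s x)) == k].
Proof.
rewrite (_ : [set _ | _] = [set x : M.-tuple R | (minn l (M - s) == k.1) /\
    [set x : M.-tuple R | (0 < lsum (take l (take l (drop s x)))) == k.2] x]).
  apply: measurable_cond; case: (k.2).
    rewrite (_ : [set _ | _] = [set x : M.-tuple R | 0 < lsum (take l (take l (drop s x)))]).
      by apply: measurable_gtr_set; exact: measurable_lsum_piece.
    by apply/seteqP; split=> x /=; rewrite eqb_id.
  rewrite (_ : [set _ | _] = ~` [set x : M.-tuple R | 0 < lsum (take l (take l (drop s x)))]).
    by apply: measurableC; apply: measurable_gtr_set; exact: measurable_lsum_piece.
  by apply/seteqP; split=> x /=; rewrite eqbF_neg => /negP.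
apply/seteqP; split=> x; case: k => k b /=;
  rewrite /block_code size_take_min size_drop size_tuple (take_takel _ (leqnn l)) xpair_eqE.
  by move/andP.
by move=> [? ?]; apply/andP.
Qed.

(** Once the code is fixed, the blocks sit at fixed positions, so matching amounts to finitely many
    conditions on partial sums. *)
Lemma measurable_matches e c : measurable [set x : M.-tuple R | matches e c x].
Proof.
pose piece k (x : seq R) := take (nth 0 (map fst c) k)%N (drop (sumn (take k (map fst c))) x).
rewrite (_ : [set _ | _] = [set x : M.-tuple R | (sumn (map fst c) <= M)%N /\
   ([set x : M.-tuple R | all (fun k => is_block e (piece k x)) (iota 0 (size c))] `&`
    [set x : M.-tuple R |
       all (fun k => block_code (piece k x) == nth (0, false)%N c k) (iota 0 (size c))]) x]).
  apply: measurable_cond; apply: measurableI.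
    apply: (@measurable_all_set _ _ _ _ (fun k x => is_block e (piece k x))) => k.
    exact: measurable_is_block.
  apply: (@measurable_all_set _ _ _ _ (fun k x => block_code (piece k x) == nth (0, false)%N c k)) => k.
  exact: measurable_block_code.
apply/seteqP; split=> x /=; rewrite /matches size_tuple.
  move=> /and3P[sz ab /eqP cE]; split=> //; split; apply/allP => k; rewrite mem_iota add0n /= => kc;
    rewrite /piece -nth_reshape.
    by apply: (allP ab); rewrite mem_nth // size_reshape size_map.
  by rewrite -[in X in _ == X]cE (nth_map [::]) // size_reshape size_map.
move=> [-> [/allP H1 /allP H2]] /=; apply/andP; split.
  apply/(all_nthP [::]) => k; rewrite size_reshape size_map => kc.
  by rewrite nth_reshape; apply: H1; rewrite mem_iota.
apply/eqP; apply: (@eq_from_nth _ (0, false)%N); first by rewrite !size_map size_reshape size_map.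
move=> k; rewrite size_map size_reshape size_map => kc.
rewrite (nth_map [::]) ?size_reshape ?size_map // nth_reshape.
by apply/eqP; apply: H2; rewrite mem_iota.
Qed.

(** The default value 0 makes this total; it agrees with [code_reversal] for codes of total length
    at most [M], see [tuple_reversalE]. *)
Definition tuple_reversal c1 c2 x : M.-tuple R :=
  [tuple nth 0 (code_reversal (c1, c2) x) i | i < M].

Lemma tuple_reversalE c1 c2 x : (sumn (map fst (c1 ++ c2)) <= M)%N ->
  tuple_reversal c1 c2 x = code_reversal (c1, c2) x :> seq R.
Proof.
move=> sz; apply: (@eq_from_nth _ 0); first by rewrite size_tuple size_code_reversal ?size_tuple.
move=> i; rewrite size_tuple => iM.
by rewrite -[i]/(nat_of_ord (Ordinal iM)) -tnth_nth tnth_mktuple.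
Qed.

(** The permutation is read from [swap_blocks] applied to the list of indices; the sign is negative
    exactly on the reversed range. *)
Lemma tuple_reversal_signed_perm c1 c2 : (sumn (map fst (c1 ++ c2)) <= M)%N ->
  exists2 s : 'I_M -> 'I_M, injective s & exists eps : 'I_M -> bool,
  forall x i, tnth (tuple_reversal c1 c2 x) i = (-1) ^+ eps i * tnth x (s i).
Proof.
rewrite map_cat sumn_cat; set p := sumn (map fst c1); set ls := map fst c2 => sz.
pose s0 := swap_blocks p ls (iota 0 M).
have ps0 : perm_eq s0 (iota 0 M) by exact: perm_swap_blocks.
have szs0 : size s0 = M by rewrite (perm_size ps0) size_iota.
have s0M i : (i < M)%N -> (nth 0 s0 i < M)%N.
  move=> iM; have : nth 0%N s0 i \in iota 0 M by rewrite -(perm_mem ps0) mem_nth ?szs0.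
  by rewrite mem_iota.
exists (fun i : 'I_M => Ordinal (s0M i (ltn_ord i))).
  move=> i j /(congr1 val) /= /eqP; rewrite nth_uniq ?szs0 // ?(perm_uniq ps0) ?iota_uniq //.
  by move=> /eqP /val_inj.
exists (fun i : 'I_M => (p <= i < p + sumn ls)%N) => x i.
rewrite tnth_mktuple /code_reversal nth_reversal ?size_tuple //; congr (_ * _).
  by case: ifP.
have E : x = map (nth 0 x) (iota 0 M) :> seq R.
  by rewrite -[in iota _ _](size_tuple x) -/(mkseq _ _) mkseq_nth.
rewrite [in LHS]E -map_swap_blocks (nth_map 0%N) ?(tnth_nth 0) //.
by rewrite szs0.
Qed.

Lemma measurable_tuple_reversal c1 c2 : (sumn (map fst (c1 ++ c2)) <= M)%N ->
  measurable_fun setT (tuple_reversal c1 c2).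
Proof.
move=> /tuple_reversal_signed_perm[s _ [eps H]].
apply/measurable_fun_tnthP => i.
rewrite (_ : _ \o _ = (fun x => (-1) ^+ eps i * tnth x (s i))).
  by apply: measurable_funM => //; exact: measurable_tnth.
by apply/funext => x; exact: H.
Qed.

End tuple_measurable.

(** * Comparison of discrete laws by summing over codes *)

Definition reversal_code : countType := (seq (nat * bool) * seq (nat * bool))%type.

Section core_inequality.
Context d (T : measurableType d) (R : realType) (P : probability T R).
Implicit Types (W : T -> R -> R).

Lemma measurable_exists (I : countType) (Q : I -> set T) :
  (forall c, measurable (Q c)) -> measurable [set om | exists c, Q c om].
Proof.
move=> mQ; rewrite (_ : [set _ | _] = \bigcup_(i in [set: nat])
    (if unpickle i is Some c then Q c else set0)).
  by apply: bigcupT_measurable => i; case: unpickle.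
apply/seteqP; split=> [om [c Qc]|om [i _]]; first by exists (pickle c) => //; rewrite pickleK.
by case: unpickle => // c Qc; exists c.
Qed.

(** The source needs only subadditivity; disjointness of the [Q' c] makes the sum on the target side
    exact. *)
Lemma le_measure_exists (I : countType) (Q Q' : I -> set T) :
  (forall c, measurable (Q c)) -> (forall c, measurable (Q' c)) ->
  (forall c1 c2 om, Q' c1 om -> Q' c2 om -> c1 = c2) ->
  (forall c, (P (Q c) <= P (Q' c))%E) ->
  (P [set om | exists c, Q c om] <= P [set om | exists c, Q' c om])%E.
Proof.
move=> mQ mQ' inj QQ'.
(* [pickle_inv] lists each code at one index only, as disjointness requires. *)
pose E (Q : I -> set T) i := if @pickle_inv I i is Some c then Q c else set0.
have mE q : (forall c, measurable (q c)) -> forall i, measurable (E q i).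
  by move=> mq i; rewrite /E; case: pickle_inv.
have EE q : [set om | exists c, q c om] = \bigcup_i E q i.
  apply/seteqP; split=> [om [c qc]|om [i _]].
    by exists (pickle c) => //; rewrite /E pickleK_inv.
  by rewrite /E; case: pickle_inv => // c qc; exists c.
rewrite !EE [X in (_ <= X)%E]measure_bigcup //; last 2 first.
- by move=> i _; exact: mE.
- apply/trivIsetP => i j _ _ ij; rewrite -subset0 => om [].
  rewrite /E; case Ei: (@pickle_inv I i) => [c1|//] Q1.
  case Ej: (@pickle_inv I j) => [c2|//] Q2.
  move: ij; rewrite (inj _ _ _ Q1 Q2) in Ei.
  have := @pickle_invK I i; have := @pickle_invK I j; rewrite Ei Ej /= => -> ->.
  by rewrite eqxx.
apply: (@le_trans _ _ (\sum_(i <oo) P (E Q i))%E).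
  by apply: measure_sigma_subadditive => //; [exact: mE|apply: bigcupT_measurable; exact: mE].
rewrite [leRHS](_ : _ = \sum_(i <oo) P (E Q' i))%E; last by apply: eq_eseriesl => i; rewrite in_setT.
apply: lee_nneseries => // i _; by rewrite /E; case: pickle_inv.
Qed.

Definition increments_tuple N M (w : R -> R) : M.-tuple R :=
  @Tuple M R (increments N M w) (introT eqP (size_increments N M w)).

Lemma measurable_increments W N M : is_brownian_motion P W ->
  measurable_fun setT (fun om => increments_tuple N M (W om)).
Proof.
move=> [mW _ _ _]; apply/measurable_fun_tnthP => i.
rewrite (_ : _ \o _ = (fun om => W om (i.+1%:R / N%:R)) \- (fun om => W om (i%:R / N%:R))).
  by apply: measurable_funB; apply: mW; rewrite divr_ge0.
apply/funext => om /=; rewrite (tnth_nth 0) /= (nth_map 0%N) ?size_iota //.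
by rewrite nth_iota // add0n.
Qed.

Lemma increments_law W N M (B : 'I_M -> set R) : is_brownian_motion P W -> (0 < N)%N ->
  (forall i, measurable (B i)) ->
  P [set om | forall i, B i (tnth (increments_tuple N M (W om)) i)] =
  (\prod_(i < M) normal_prob 0 (Num.sqrt (N%:R^-1)) (B i))%E.
Proof.
move=> [_ _ _ law] N0 mB.
have Nr : 0 < N%:R :> R by rewrite ltr0n.
pose B' i := if insub i is Some j then B j else setT.
have B'E (i : 'I_M) : B' i = B i.
  by rewrite /B' insubT // => iM; congr B; exact: val_inj.
have := law M (fun i => i%:R / N%:R) B'.
rewrite mul0r lexx => /(_ isT).
have -> : [set om | forall i, B i (tnth (increments_tuple N M (W om)) i)] =
    \bigcap_(i in `I_M) [set om | B' i (W om (i.+1%:R / N%:R) - W om (i%:R / N%:R))].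
  have tE om (i : 'I_M) : tnth (increments_tuple N M (W om)) i =
      W om (i.+1%:R / N%:R) - W om (i%:R / N%:R).
    by rewrite (tnth_nth 0) /= (nth_map 0%N) ?size_iota // nth_iota.
  apply/seteqP; split=> om H i.
    by move=> /= iM; have := H (Ordinal iM); rewrite tE -B'E.
  by rewrite tE -B'E; apply: H => /=.
move=> ->; last 2 first.
- by move=> i _; rewrite ltr_pM2r ?invr_gt0 // ltr_nat.
- by move=> i iM; rewrite -[i]/(nat_of_ord (Ordinal iM)) B'E.
have dE (i : nat) : i.+1%:R / N%:R - i%:R / N%:R = N%:R^-1 :> R.
  by rewrite -mulrBl -natrB // subSnn mul1r.
by apply: eq_bigr => i _; rewrite B'E dE.
Qed.

Lemma measurable_match_at W N M (p : Prop) (e : R) c (D : set (M.-tuple R)) :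
  is_brownian_motion P W -> measurable D ->
  measurable [set om | p /\ matches e c (increments_tuple N M (W om)) /\
                       D (increments_tuple N M (W om))].
Proof.
move=> bm mD; apply: (@measurable_cond _ _ p ((fun om => increments_tuple N M (W om)) @^-1`
  ([set x : M.-tuple R | matches e c x] `&` D))).
have mC : measurable ([set x : M.-tuple R | matches e c x] `&` D).
  by apply: measurableI => //; exact: measurable_matches.
by have := @measurable_increments W N M bm measurableT _ mC; rewrite setTI.
Qed.

Lemma measurable_reversal_at W N M (p : Prop) (e : R) (c : reversal_code)
    (D : set (M.-tuple R)) :
  is_brownian_motion P W -> measurable D ->
  measurable [set om | p /\ matches e (c.1 ++ c.2) (increments_tuple N M (W om)) /\
    D (tuple_reversal c.1 c.2 (increments_tuple N M (W om)))].
Proof.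
move=> bm mD; have [cM|ncM] := pselect (sumn (map fst (c.1 ++ c.2)) <= M)%N; last first.
  rewrite (_ : [set _ | _] = set0) // -subset0 => om [_ [/and3P[+ _ _]]] _.
  by rewrite size_tuple.
apply: (@measurable_match_at W N M p e (c.1 ++ c.2) (tuple_reversal c.1 c.2 @^-1` D)) => //.
by rewrite -[X in measurable X]setTI; exact: measurable_tuple_reversal.
Qed.

(** For each code the reversed tuple has the law of the increments and matches the dual code, which
    bounds [P (Q c)] by [P (Q' c)]. The [Q' c] are disjoint because a word matches at most one
    admissible code, and dual codes leave downwards. *)
Lemma le_reversal_event W N M (e : R) (a r : int) (D : set (M.-tuple R)) :
  is_brownian_motion P W -> (0 < N)%N -> 0 < e -> 0 < r -> measurable D ->
  (P [set om | exists c : reversal_code, admissible true a r c /\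
        matches e (c.1 ++ c.2) (increments_tuple N M (W om)) /\
        D (tuple_reversal c.1 c.2 (increments_tuple N M (W om)))] <=
   P [set om | exists c : reversal_code, admissible false a r c /\
        matches e (c.1 ++ c.2) (increments_tuple N M (W om)) /\
        D (increments_tuple N M (W om))])%E.
Proof.
move=> bm N0 e0 r0 mD; set X := fun om => increments_tuple N M (W om).
have mX : measurable_fun setT X by exact: measurable_increments.
pose Q (c : reversal_code) := [set om | admissible true a r c /\
  matches e (c.1 ++ c.2) (X om) /\ D (tuple_reversal c.1 c.2 (X om))].
pose Q' (c : reversal_code) := [set om | admissible true a r c /\
  matches e ((code_dual c).1 ++ (code_dual c).2) (X om) /\ D (X om)].
pose Q2 (c : reversal_code) := [set om | admissible false a r c /\
  matches e (c.1 ++ c.2) (X om) /\ D (X om)].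
have mQ c : measurable (Q c) by exact: measurable_reversal_at.
have mQ' c : measurable (Q' c) by exact: measurable_match_at.
have mQ2 c : measurable (Q2 c) by exact: measurable_match_at.
apply: (@le_trans _ _ (P [set om | exists c, Q' c om])); last first.
  apply: le_measure; rewrite ?inE; [exact: measurable_exists|exact: (measurable_exists mQ2)|].
  by move=> om [c [adm H]]; exists (code_dual c); split=> //; exact: (admissible_dual adm).
apply: (@le_measure_exists _ Q Q') => //.
  move=> c1 c2 om [ad1 [m1 _]] [ad2 [m2 _]].
  have ad1' := admissible_dual ad1; have ad2' := admissible_dual ad2.
  suff : code_dual c1 = code_dual c2 by move/(can_inj code_dualK).
  have [le|/ltnW le] := leqP (size ((code_dual c1).1 ++ (code_dual c1).2))
      (size ((code_dual c2).1 ++ (code_dual c2).2)).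
    exact: (admissible_prefix_eq r0 ad1' ad2' (matches_prefix m1 m2 le)).
  exact/esym/(admissible_prefix_eq r0 ad2' ad1' (matches_prefix m2 m1 le)).
move=> c; have [cM|ncM] := pselect (sumn (map fst (c.1 ++ c.2)) <= M)%N; last first.
  rewrite (_ : Q c = set0) ?measure0 // -subset0 => om [_ [/and3P[+ _ _]]] _.
  by rewrite size_tuple.
have [adm|nadm] := pselect (admissible true a r c); last first.
  by rewrite (_ : Q c = set0) ?measure0 // -subset0 => om [].
pose C := [set x : M.-tuple R | matches e ((code_dual c).1 ++ (code_dual c).2) x] `&` D.
have mC : measurable C by apply: measurableI => //; exact: measurable_matches.
have mY : measurable_fun setT (fun om => tuple_reversal c.1 c.2 (X om)).
  by apply: measurableT_comp => //; exact: measurable_tuple_reversal.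
apply: (@le_trans _ _ (P ((fun om => tuple_reversal c.1 c.2 (X om)) @^-1` C))).
  apply: le_measure; rewrite ?inE //.
    by rewrite -[X in measurable X]setTI; exact: mY.
  move=> om [_ [mc Dc]]; split => //=; rewrite tuple_reversalE //.
  by have := matches_reversal e0 mc; case: (c).
have [s sinj [eps Hs]] := tuple_reversal_signed_perm R cM.
rewrite -(@signed_perm_law _ _ _ P M (normal_prob 0 (Num.sqrt N%:R^-1)) X _ s eps) //.
- by apply: le_measure; rewrite ?inE // -[X in measurable X]setTI; exact: mX.
- move=> B mB; apply: normal_probN => //.
  by rewrite gt_eqF // sqrtr_gt0 invr_gt0 ltr0n.
- by move=> B mB; exact: increments_law.
Qed.

End core_inequality.

(** * Continuous functionals of finitely many values of a path *)

Section functionals.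
Variable R : realType.
Implicit Types (w v : R -> R) (S : seq R) (f : (R -> R) -> R).

(** Uniform continuity in the values on [S] forces [f] to depend on these values only. Measurability
    is asked along every process, so that it serves Brownian paths and discrete walks on tuples
    alike. *)
Definition cylinder_functional S f := [/\ forall t, t \in S -> 0 <= t,
  forall e, 0 < e -> exists2 k, 0 < k & forall v v',
    (forall t, t \in S -> `|v t - v' t| < k) -> `|f v - f v'| < e &
  forall d (T : measurableType d) (V : T -> R -> R),
    (forall t, t \in S -> measurable_fun setT (V ^~ t)) ->
    measurable_fun setT (fun x => f (V x))].

Lemma cylinder_functional_addr S f a : cylinder_functional S f ->
  cylinder_functional S (fun v => f v + a).
Proof.
move=> [S0 cf mf]; split=> //.
  move=> e e0; have [k k0 H] := cf e e0; exists k => // v v' /H.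
  by rewrite opprD addrACA subrr addr0.
by move=> d T V mV; apply: measurable_funD => //; exact: mf.
Qed.

Lemma cylinder_functional_opp S f : cylinder_functional S f ->
  cylinder_functional S (fun v => - f v).
Proof.
move=> [S0 cf mf]; split=> //.
  move=> e e0; have [k k0 H] := cf e e0; exists k => // v v' /H.
  by rewrite -opprD normrN.
by move=> d T V mV; apply: measurable_funN; exact: mf.
Qed.

Lemma near2_all S (Q : nat -> nat -> R -> Prop) :
  (forall t, t \in S -> \forall n \near \oo, \forall N \near \oo, Q n N t) ->
  \forall n \near \oo, \forall N \near \oo, forall t, t \in S -> Q n N t.
Proof.
elim: S => [_|a S IHS H]; first by apply: nearW => n; apply: nearW => N t; rewrite in_nil.
have Ha := H a (mem_head _ _).
have HS := IHS (fun t tS => H t (mem_behead (s := a :: S) tS)).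
near=> n; near=> N => t; rewrite inE => /predU1P[->|tS].
  by near: N; near: n.
by move: t tS; near: N; near: n.
Unshelve. all: by end_near.
Qed.

Lemma near2_and (Q Q' : nat -> nat -> Prop) :
  (\forall n \near \oo, \forall N \near \oo, Q n N) ->
  (\forall n \near \oo, \forall N \near \oo, Q' n N) ->
  \forall n \near \oo, \forall N \near \oo, Q n N /\ Q' n N.
Proof.
move=> H H'; apply: filterS2 H H' => n; exact: filterI.
Qed.

End functionals.

(** * The inequality between the laws on exit events *)

Section exit_inequality.
Context d (T : measurableType d) (R : realType) (P : probability T R).
Variables (W : T -> R -> R) (S : seq R) (K : nat).
Hypotheses (bm : is_brownian_motion P W) (cW : forall om, continuous (W om)).
Hypothesis SK : forall t, t \in S -> t <= K%:R.
Implicit Types (f : (R -> R) -> R) (a : R) (n N : nat) (om : T).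

Let W0 om : W om 0 = 0.
Proof. by case: bm. Qed.

Definition superlevel f a N : set ((K * N).-tuple R) := [set x | a < f (walk N x)].

Definition reversed_event f a n N := [set om | exists c : reversal_code,
  admissible true 8 (radius n) c /\
  matches n%:R^-1 (c.1 ++ c.2) (increments_tuple N (K * N) (W om)) /\
  superlevel f a (tuple_reversal c.1 c.2 (increments_tuple N (K * N) (W om)))].

Definition forward_event f a n N := [set om | exists c : reversal_code,
  admissible false 8 (radius n) c /\
  matches n%:R^-1 (c.1 ++ c.2) (increments_tuple N (K * N) (W om)) /\
  superlevel f a (increments_tuple N (K * N) (W om))].

Lemma measurable_superlevel f a N : cylinder_functional S f ->
  measurable (superlevel f a (N := N)).
Proof.
move=> [_ _ mf]; apply: measurable_gtr_set; apply: mf => t _; exact: measurable_walk.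
Qed.

Lemma measurable_reversed_event f a n N : cylinder_functional S f ->
  measurable (reversed_event f a n N).
Proof.
move=> cf; apply: (@measurable_exists _ _ _ (fun c => [set om | admissible true 8 (radius n) c /\
  matches n%:R^-1 (c.1 ++ c.2) (increments_tuple N (K * N) (W om)) /\
  superlevel f a (tuple_reversal c.1 c.2 (increments_tuple N (K * N) (W om)))])) => c.
by apply: (@measurable_reversal_at _ _ _ P W N (K * N)) => //; exact: measurable_superlevel.
Qed.

Lemma measurable_forward_event f a n N : cylinder_functional S f ->
  measurable (forward_event f a n N).
Proof.
move=> cf; apply: (@measurable_exists _ _ _ (fun c => [set om | admissible false 8 (radius n) c /\
  matches n%:R^-1 (c.1 ++ c.2) (increments_tuple N (K * N) (W om)) /\
  superlevel f a (increments_tuple N (K * N) (W om))])) => c.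
by apply: (@measurable_match_at _ _ _ P W N (K * N)) => //; exact: measurable_superlevel.
Qed.

Lemma near_reversed_close f e om : cylinder_functional S f -> 0 < e -> exits true K (W om) ->
  \forall n \near \oo, \forall N \near \oo, forall c, matching true n N K (W om) c ->
    `|f (walk N (tuple_reversal c.1 c.2 (increments_tuple N (K * N) (W om)))) -
      f (qtr (W om))| < e.
Proof.
move=> [S0 cf _] e0 ex; have [k k0 Hk] := cf e e0.
have := near2_all (fun (t : R) (tS : t \in S) => near_walk_reversal (@cW om) (W0 om) ex
  (introT andP (conj (S0 t tS) (SK tS))) k0).
apply: filterS => n; apply: filterS => N H c mc; apply: Hk => t tS.
have [_ /and3P[sz _ _]] := mc; rewrite size_increments in sz.
by rewrite tuple_reversalE //; have := H t tS c mc; case: (c).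
Qed.

Lemma near_forward_close f e om : cylinder_functional S f -> 0 < e ->
  \forall n \near \oo, \forall N \near \oo,
    `|f (walk N (increments_tuple N (K * N) (W om))) - f (W om)| < e.
Proof.
move=> [S0 cf _] e0; have [k k0 Hk] := cf e e0.
have := near2_all (fun (t : R) (tS : t \in S) => near_walk (@cW om) (W0 om)
  (introT andP (conj (S0 t tS) (SK tS))) k0).
by apply: filterS => n; apply: filterS => N H; apply: Hk.
Qed.

Lemma near_reversed_event f a om : cylinder_functional S f -> exits true K (W om) ->
  a < f (qtr (W om)) -> \forall n \near \oo, \forall N \near \oo, reversed_event f a n N om.
Proof.
move=> cf ex fa; have fa0 : 0 < f (qtr (W om)) - a by rewrite subr_gt0.
have H1 := near_matching_exists (@cW om) (W0 om) ex.
have H2 := near_reversed_close cf fa0 ex.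
apply: filterS (near2_and H1 H2) => n; apply: filterS => N [[c mc] H].
have [adm mm] := mc; exists c; split=> //; split=> //.
by rewrite /superlevel /=; have := H c mc; rewrite ltr_norml => /andP[? _]; lra.
Qed.

(** A converse of [near_reversed_event], up to replacing a strict inequality by a weak one. *)
Lemma reversed_event_limit f a om : cylinder_functional S f ->
  (\forall n \near \oo, \forall N \near \oo, reversed_event f a n N om) ->
  exits true K (W om) /\ a <= f (qtr (W om)).
Proof.
move=> cf H.
have ex : exits true K (W om).
  have [n Hn] := filter_ex (near2_and H (near_matching_exits true K (@cW om) (W0 om))).
  by have [N [[c [adm [mm _]]] HN]] := filter_ex Hn; apply: (HN c).
split=> //; rewrite leNgt; apply/negP => fa.
have fa0 : 0 < a - f (qtr (W om)) by rewrite subr_gt0.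
have [n Hn] := filter_ex (near2_and H (near_reversed_close cf fa0 ex)).
have [N [[c [adm [mm]]] ]] := filter_ex Hn.
rewrite /superlevel /= => af /(_ c (conj adm mm)).
by rewrite ltr_norml => /andP[_]; rewrite ltrD2r ltNge (ltW af).
Qed.

Lemma forward_event_limit f om : cylinder_functional S f -> forall a, 0 < a ->
  ~ (exits false K (W om) /\ 0 < f (W om)) ->
  \forall n \near \oo, \forall N \near \oo, ~ forward_event f a n N om.
Proof.
move=> cf a a0 nB.
have H1 := near_matching_exits false K (@cW om) (W0 om).
have H2 := near_forward_close om cf a0.
apply: filterS (near2_and H1 H2) => n; apply: filterS => N [H3 H4] [c [adm [mm]]].
rewrite /superlevel /= => af; apply: nB; split; first exact: (H3 c).
by move: H4; rewrite ltr_norml => /andP[_ ?]; lra.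
Qed.

(** The event is a countable union, over positive thresholds, of lower limits of discrete events.
    This bypasses the measurability of [tau] and [gtau]. *)
Lemma measurable_exits_qtr f : cylinder_functional S f ->
  measurable [set om | exits true K (W om) /\ 0 < f (qtr (W om))].
Proof.
move=> cf; rewrite (_ : [set _ | _] = \bigcup_k [set om |
    \forall n \near \oo, \forall N \near \oo, reversed_event f k.+1%:R^-1 n N om]).
  apply: bigcupT_measurable => k; apply: measurable_near2 => n N.
  exact: measurable_reversed_event.
apply/seteqP; split=> om.
  move=> [ex f0]; have [k _ Hk] := near_infty_natSinv_lt (PosNum f0).
  by exists k => //; apply: near_reversed_event => //; apply: (Hk k) => /=.
move=> [k _ /(reversed_event_limit cf)[ex fk]]; split=> //.
exact: lt_le_trans fk.
Qed.

(** The thresholds [k.+1%:R^-1] absorb the discretization error: a discrete value above the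
    threshold forces a positive value in the limit. They are removed by a second use of Fatou. *)
Lemma exits_qtr_le f : cylinder_functional S f ->
  measurable [set om | exits false K (W om)] ->
  (P [set om | exits true K (W om) /\ (0 < f (qtr (W om)))%R] <=
   P [set om | exits false K (W om) /\ (0 < f (W om))%R])%E.
Proof.
move=> cf mE.
have mfW : measurable [set om | 0 < f (W om)].
  have [S0 _ mf] := cf; apply: measurable_gtr_set; apply: mf => t tS.
  by case: bm => mW _ _ _; apply: mW; exact: S0.
have mB : measurable [set om | exits false K (W om) /\ 0 < f (W om)] by exact: measurableI.
have mA k : measurable [set om | exits true K (W om) /\ k.+1%:R^-1 < f (qtr (W om))].
  have := measurable_exits_qtr (cylinder_functional_addr (- k.+1%:R^-1) cf).
  by under eq_set do rewrite subr_gt0.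
apply: (@le_measure_near _ _ _ P
  (fun k => [set om | exits true K (W om) /\ k.+1%:R^-1 < f (qtr (W om))])
  (fun=> [set om | exits false K (W om) /\ 0 < f (W om)])) => //.
- exact: measurable_exits_qtr.
- move=> om [ex f0]; have := near_infty_natSinv_lt (PosNum f0).
  by apply: filterS.
- by move=> om nB; exact: nearW.
apply: nearW => k; have k0 : 0 < k.+1%:R^-1 :> R by [].
apply: (@le_measure_near2 _ _ _ P (reversed_event f k.+1%:R^-1) (forward_event f k.+1%:R^-1)) => //.
- by move=> n N; exact: measurable_reversed_event.
- by move=> n N; exact: measurable_forward_event.
- by move=> om [ex fk]; exact: near_reversed_event.
- by move=> om; exact: forward_event_limit.
near=> n; near=> N; apply: le_reversal_event => //.
- by near: N; exists 1%N.
- by rewrite invr_gt0 ltr0n; near: n; exists 1%N.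
- have : (16 < n)%N by near: n; exists 17%N.
  by rewrite /radius; lia.
- exact: measurable_superlevel.
Unshelve. all: by end_near.
Qed.

End exit_inequality.

Lemma measurable_exits d (T : measurableType d) (R : realType) (P : probability T R)
    (W : T -> R -> R) (K : nat) : is_brownian_motion P W ->
  (forall om, continuous (W om)) -> measurable [set om | exits true K (W om)].
Proof.
(* With the constant functional 1 the condition on [f] is always true and only the exit remains. *)
move=> bm cW; have cf : cylinder_functional [::] (fun _ : R -> R => 1 : R).
  split=> //; first by move=> e e0; exists 1 => // v v' _; rewrite subrr normr0.
have SK t : t \in [::] -> t <= K%:R :> R by [].
have := measurable_exits_qtr bm cW SK cf.
rewrite (_ : [set _ | _] = [set om | exits true K (W om)]) //.
by apply/seteqP; split=> om // [].
Qed.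

(** * Invariance of Brownian motion *)

Section negation.
Variable R : realType.
Implicit Types (w : R -> R) (s : bool) (t : R) (S : seq R) (f : (R -> R) -> R).

Lemma hit_setN w : hit_set (fun t => - w t) = hit_set w.
Proof. by apply/seteqP; split=> t; rewrite /hit_set /= normrN. Qed.

Lemma tauN w : tau (fun t => - w t) = tau w.
Proof. by rewrite /tau hit_setN. Qed.

Lemma gtauN w : gtau (fun t => - w t) = gtau w.
Proof.
rewrite /gtau tauN; congr sup; apply/seteqP; split=> t /= [? [? /eqP]];
  by rewrite ?oppr_eq0 => /eqP ->; rewrite ?oppr0.
Qed.

Lemma continuous_opp w : continuous w -> continuous (fun t => - w t).
Proof. by move=> cw t; apply: cvgN; exact: cw. Qed.

Lemma qtrN w : continuous w -> w 0 = 0 -> qtr (fun t => - w t) = (fun t => - qtr w t).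
Proof.
move=> cw w0; apply/funext => t; have cw' := continuous_opp cw.
have w0' : - w 0 = 0 by rewrite w0 oppr0.
have [h0|nh] := pselect (hit_set w !=set0).
  have h0' : hit_set (fun t => - w t) !=set0 by rewrite hit_setN.
  by rewrite !qtrE // tauN gtauN /theta; ring.
by rewrite /qtr hit_setN asboolF.
Qed.

Lemma exitsN w s K : exits s K (fun t => - w t) <-> exits (~~ s) K w.
Proof.
rewrite /exits hit_setN tauN; split=> -[? ? E]; split=> //.
  by rewrite -[LHS]opprK E; case: (s) => /=; rewrite ?opprK.
by rewrite E; case: (s); rewrite /= ?opprK.
Qed.

Lemma hit_exits w : continuous w -> w 0 = 0 -> hit_set w !=set0 ->
  exists s K, exits s K w.
Proof.
move=> cw w0 h0; have [_ wtau _] := tauP cw w0 h0.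
exists (w (tau w) == 1), (Num.truncn (tau w)).+1; split=> //.
  by rewrite ltW // truncnS_gt.
case: eqP => // w1.
by move: wtau w1; case: (ltrgt0P (w (tau w))) => _; lra.
Qed.

Lemma cylinder_functional_neg_path S f : cylinder_functional S f ->
  @cylinder_functional R S (fun v => f (fun t => - v t)).
Proof.
move=> [S0 cf mf]; split=> //.
  move=> e e0; have [k k0 H] := cf e e0; exists k => // v v' Hv; apply: H => t tS.
  by rewrite -opprD normrN; exact: Hv.
move=> d T V mV; apply: (mf d T (fun x t => - V x t)) => t tS.
by apply: measurable_funN; exact: mV.
Qed.

Lemma horizon_exists S : exists K : nat, forall t, t \in S -> t <= K%:R.
Proof.
elim: S => [|a S [K HK]]; first by exists 0%N.
exists (K + (Num.truncn a).+1)%N => t; rewrite inE natrD => /predU1P[->|/HK tK].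
  by rewrite (le_trans (ltW (truncnS_gt a))) // lerDr.
by rewrite (le_trans tK) // lerDl.
Qed.

End negation.

Section brownian.
Context d (T : measurableType d) (R : realType) (P : probability T R).
Implicit Types (W : T -> R -> R) (S : seq R) (f : (R -> R) -> R).

Lemma brownian_opp W : is_brownian_motion P W ->
  is_brownian_motion P (fun om t => - W om t).
Proof.
move=> [mW W0 cW law]; split.
- by move=> t t0; apply: measurable_funN; exact: mW.
- by move=> om; rewrite W0 oppr0.
- by move=> om t; apply: cvgN; exact: cW.
move=> n ts B ts0 tsi mB; have := law n ts (fun i => -%R @^-1` B i) ts0 tsi.
move=> /(_ _) H; transitivity (\prod_(i < n)
    normal_prob 0 (Num.sqrt (ts i.+1 - ts i)) (-%R @^-1` B i))%E.
  rewrite -H; last first.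
    by move=> i /mB mBi; rewrite -[X in measurable X]setTI; exact: oppr_measurable.
  congr (P _); apply: eq_bigcapr => i _; apply/seteqP; split=> om /=; by rewrite opprB opprK addrC.
apply: eq_bigr => i _; apply: normal_probN; last exact: mB.
by rewrite gt_eqF // sqrtr_gt0 subr_gt0 tsi.
Qed.

Lemma measurable_exits_all W s K : is_brownian_motion P W ->
  (forall om, continuous (W om)) -> measurable [set om | exits s K (W om)].
Proof.
move=> bm cW; case: s; first exact: (measurable_exits K bm cW).
have := @measurable_exits _ _ _ P (fun om t => - W om t) K (brownian_opp bm)
  (fun om => continuous_opp (cW om)).
rewrite (_ : [set _ | _] = [set om | exits false K (W om)]) //.
by apply/seteqP; split=> om; have [H1 H2] := exitsN (W om) true K; [exact: H1|exact: H2].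
Qed.

Lemma measurable_ever_exits W s : is_brownian_motion P W ->
  (forall om, continuous (W om)) -> measurable [set om | exists K, exits s K (W om)].
Proof.
move=> bm cW; rewrite (_ : [set _ | _] = \bigcup_K [set om | exits s K (W om)]).
  by apply: bigcupT_measurable => K; exact: measurable_exits_all.
by apply/seteqP; split=> om; [case=> K E; exists K|case=> K _ E; exists K].
Qed.

Lemma measurable_cylinder W S f : is_brownian_motion P W -> cylinder_functional S f ->
  measurable_fun setT (fun om => f (W om)).
Proof.
by move=> [mW _ _ _] [S0 _ mf]; apply: mf => t tS; apply: mW; exact: S0.
Qed.

Lemma exits_leS w s K K' : (K <= K')%N -> exits s K w -> @exits R s K' w.
Proof. by move=> KK' [h0 tK w1]; split=> //; rewrite (le_trans tK) // ler_nat. Qed.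

Lemma ever_exits_qtr_le W S f : is_brownian_motion P W ->
  (forall om, continuous (W om)) -> cylinder_functional S f ->
  measurable [set om | (exists K, exits true K (W om)) /\ 0 < f (qtr (W om))] /\
  (P [set om | (exists K, exits true K (W om)) /\ (0 < f (qtr (W om)))%R] <=
   P [set om | (exists K, exits false K (W om)) /\ (0 < f (W om))%R])%E.
Proof.
move=> bm cW cf; have [K0 HK0] := horizon_exists S.
(* Adding [K0] makes every horizon [K + K0] exceed the times in [S]. *)
have SK K : forall t, t \in S -> t <= (K + K0)%:R.
  by move=> t /HK0 tK; rewrite (le_trans tK) // ler_nat leq_addl.
have mA K : measurable [set om | exits true (K + K0)%N (W om) /\ 0 < f (qtr (W om))].
  exact: (measurable_exits_qtr bm cW (SK K) cf).
have mE s K : measurable [set om | exits s K (W om)] by exact: measurable_exits_all.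
have mf : measurable [set om | 0 < f (W om)].
  by apply: measurable_gtr_set; exact: measurable_cylinder cf.
have mL : measurable [set om | (exists K, exits true K (W om)) /\ 0 < f (qtr (W om))].
  rewrite (_ : [set _ | _] = \bigcup_K [set om | exits true (K + K0)%N (W om) /\ 0 < f (qtr (W om))]).
    exact: bigcupT_measurable.
  apply/seteqP; split=> om.
    by move=> [[K E] H]; exists K => //; split=> //; exact: exits_leS (leq_addr _ _) E.
  by move=> [K _ [E H]]; split=> //; exists (K + K0)%N.
split=> //.
apply: (@le_measure_near _ _ _ P
  (fun K => [set om | exits true (K + K0)%N (W om) /\ 0 < f (qtr (W om))])
  (fun K => [set om | exits false (K + K0)%N (W om) /\ 0 < f (W om)])) => //.
- by apply: measurableI => //; exact: measurable_ever_exits.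
- by move=> K; apply: measurableI => //; exact: mE.
- move=> om [[K E] H]; exists K => // K' /= KK'; split=> //.
  by apply: exits_leS E; exact: leq_trans KK' (leq_addr _ _).
- by move=> om nB; apply: nearW => K [E H]; apply: nB; split=> //; exists (K + K0)%N.
- by apply: nearW => K; exact: (exits_qtr_le bm cW (SK K) cf).
Qed.

(** Paths are split by exit side. The reversal exchanges the upper and lower exits, the inequality
    for the lower one coming from the upper one for [-W]; on paths that never exit it is the
    identity. *)
Lemma qtr_le W S f : is_brownian_motion P W ->
  (forall om, continuous (W om)) -> cylinder_functional S f ->
  measurable [set om | 0 < f (qtr (W om))] /\
  (P [set om | (0 < f (qtr (W om)))%R] <= P [set om | (0 < f (W om))%R])%E.
Proof.
move=> bm cW cf; have W0 om : W om 0 = 0 by case: bm.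
have [mA1 le1] := ever_exits_qtr_le bm cW cf.
pose E s := [set om | exists K, exits s K (W om)].
have mE s : measurable (E s) by exact: measurable_ever_exits.
have [mA2 le2] : measurable [set om | (exists K, exits false K (W om)) /\ 0 < f (qtr (W om))] /\
  (P [set om | (exists K, exits false K (W om)) /\ (0 < f (qtr (W om)))%R] <=
   P [set om | (exists K, exits true K (W om)) /\ (0 < f (W om))%R])%E.
  have := ever_exits_qtr_le (brownian_opp bm) (fun om => continuous_opp (cW om))
    (cylinder_functional_neg_path cf).
  have fE v : f (fun t => - - v t) = f v.
    by congr f; apply/funext => t; rewrite opprK.
  rewrite (_ : [set _ | _] = [set om | (exists K, exits false K (W om)) /\ 0 < f (qtr (W om))]).
    rewrite (_ : [set om | _ /\ 0 < f (fun t => - - W om t)] =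
      [set om | (exists K, exits true K (W om)) /\ 0 < f (W om)]) //.
    apply/seteqP; split=> om [[K ex]] H; (split; last by move: H; rewrite fE); exists K;
      have [H1 H2] := exitsN (W om) false K; [exact: H1|exact: H2].
  apply/seteqP; split=> om [[K ex]] H; (split; last by move: H; rewrite qtrN // fE); exists K;
    have [H1 H2] := exitsN (W om) true K; [exact: H1|exact: H2].
pose E0 := ~` (E true `|` E false).
have mE0 : measurable E0 by apply: measurableC; exact: measurableU.
have mfW : measurable [set om | 0 < f (W om)].
  by apply: measurable_gtr_set; exact: measurable_cylinder cf.
have disj : E true `&` E false = set0.
  rewrite -subset0 => om [[K [_ _ E1]] [K' [_ _ E2]]].
  by move: E2; rewrite E1; lra.
have split3 (X : set T) : X = (E true `&` X) `|` (E false `&` X) `|` (E0 `&` X).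
  by rewrite -!setIUl setUv setTI.
have P3 (X : set T) : measurable (E true `&` X) -> measurable (E false `&` X) ->
    measurable (E0 `&` X) ->
    (P X = P (E true `&` X) + P (E false `&` X) + P (E0 `&` X))%E.
  move=> m1 m2 m3; rewrite {1}(split3 X) !measureU //.
  - by rewrite setIACA disj set0I.
  - exact: measurableU.
  - by rewrite -setIUl setIACA setICr set0I.
have qtr0 om : E0 om -> qtr (W om) = W om.
  move=> nE; apply/funext => t; rewrite /qtr asboolF // => h0.
  by have [s [K ex]] := hit_exits (cW om) (W0 om) h0; apply: nE; case: s ex; [left|right]; exists K.
have A0E : E0 `&` [set om | 0 < f (qtr (W om))] = E0 `&` [set om | 0 < f (W om)].
  by apply/seteqP; split=> om [/= nE H]; split=> //=; move: H; rewrite qtr0.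
have mA0 : measurable (E0 `&` [set om | 0 < f (qtr (W om))]).
  by rewrite A0E; exact: measurableI.
split; first by rewrite (split3 [set om | 0 < f (qtr (W om))]); do 2?apply: measurableU.
have mB Z : measurable Z -> measurable (Z `&` [set om | 0 < f (W om)]).
  by move=> mZ; exact: measurableI.
rewrite (P3 _ mA1 mA2 mA0) (P3 _ (mB _ (mE true)) (mB _ (mE false)) (mB _ mE0)) A0E.
(* The commutation reflects the exchange of the two exits. *)
rewrite leeD2r // [leRHS]addeC; exact: leeD.
Qed.

(** The reverse inequality is [qtr_le] for the functional [a - f], after taking complements; [a > 0]
    then tends to 0. *)
Lemma qtr_eq W S f : is_brownian_motion P W ->
  (forall om, continuous (W om)) -> cylinder_functional S f ->
  P [set om | 0 < f (qtr (W om))] = P [set om | 0 < f (W om)].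
Proof.
move=> bm cW cf; apply/eqP; rewrite eq_le (qtr_le bm cW cf).2 /=.
have mq := (qtr_le bm cW cf).1.
have mfW : measurable_fun setT (fun om => f (W om)) by exact: measurable_cylinder cf.
apply: (@le_measure_near _ _ _ P (fun k => [set om | k.+1%:R^-1 <= f (W om)])
  (fun=> [set om | 0 < f (qtr (W om))])) => //.
- exact: measurable_gtr_set.
- by move=> k; exact: measurable_ger_set.
- move=> om f0; have := near_infty_natSinv_lt (PosNum f0).
  by apply: filterS => k /= /ltW.
- by move=> om nB; exact: nearW.
apply: nearW => k; set a : R := k.+1%:R^-1; have a0 : 0 < a by rewrite invr_gt0 ltr0n.
have cg := cylinder_functional_addr a (cylinder_functional_opp cf).
have [mg gle] := qtr_le bm cW cg.
have mgW : measurable [set om | 0 < - f (W om) + a].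
  by apply: measurable_gtr_set; exact: measurable_cylinder cg.
have CE (g : T -> R) : [set om | a <= g om] = ~` [set om | 0 < - g om + a].
  have E om : (a <= g om) = ~~ (0 < - g om + a) by rewrite addrC subr_gt0 -leNgt.
  by apply/seteqP; split=> om /=; rewrite E => /negP.
apply: (@le_trans _ _ (P [set om | a <= f (qtr (W om))])).
  rewrite !CE !probability_setC // -(fineK (fin_num_measure P _ mg)) -(fineK (fin_num_measure P _ mgW)).
  by rewrite -!EFinB lee_fin lerD2l lerN2 -lee_fin !fineK // fin_num_measure.
apply: le_measure; rewrite ?inE //; first by rewrite CE; exact: measurableC.
by move=> om /=; exact: lt_le_trans.
Qed.


End brownian.

(** * From functionals to the joint law of increments *)

Section increments_functional.
Variables (R : realType) (ts a : nat -> R).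

(** The minimum encodes an intersection of rays as the positivity of a single functional; the
    initial value 1 is a positive constant. *)
Definition increments_margin (s : seq nat) (v : R -> R) : R :=
  \big[Num.min/1]_(i <- s) (a i - (v (ts i.+1) - v (ts i))).

Lemma increments_margin_gt0 s v : (0 < increments_margin s v) <->
  (forall i, i \in s -> v (ts i.+1) - v (ts i) < a i).
Proof.
rewrite /increments_margin; elim: s => [|j s IHs]; first by rewrite big_nil ltr01; split=> // _ i.
rewrite big_cons lt_min subr_gt0; split=> [/andP[j0 /IHs H] i|H].
  by rewrite inE => /predU1P[->//|/H].
by apply/andP; split; [apply: H; rewrite mem_head|apply/IHs => i si; apply: H; rewrite inE si orbT].
Qed.

Lemma cylinder_increments_margin n : (forall i, (i <= n)%N -> 0 <= ts i) ->
  cylinder_functional [seq ts i | i <- iota 0 n.+1] (increments_margin (iota 0 n)).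
Proof.
move=> ts0.
have tsS i : (i <= n)%N -> ts i \in [seq ts i | i <- iota 0 n.+1].
  by move=> ni; apply: map_f; rewrite mem_iota.
have iotan i : i \in iota 0 n -> (i < n)%N by rewrite mem_iota.
split.
- by move=> t /mapP[i]; rewrite mem_iota => /andP[_ ni] ->; apply: ts0.
- move=> e e0; exists (e / 2); first by rewrite divr_gt0.
  move=> v v' H; rewrite /increments_margin.
  elim: (iota 0 n) iotan => [_|j s IHs js]; first by rewrite !big_nil subrr normr0.
  rewrite !big_cons; apply: min_close; last by apply: IHs => i si; apply: js; rewrite inE si orbT.
  have jn := js j (mem_head _ _).
  have := H _ (tsS j (ltnW jn)); have := H _ (tsS j.+1 jn).
  by rewrite !ltr_norml => /andP[? ?] /andP[? ?]; apply/andP; split; lra.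
- move=> d T V mV; rewrite /increments_margin.
  elim: (iota 0 n) iotan => [_|j s IHs js].
    by under eq_fun do rewrite big_nil; exact: measurable_cst.
  under eq_fun do rewrite big_cons.
  have jn := js j (mem_head _ _).
  apply: measurable_minr; last by apply: IHs => i si; apply: js; rewrite inE si orbT.
  apply: measurable_funB; first exact: measurable_cst.
  by apply: measurable_funB; apply: mV; apply: tsS => //; exact: ltnW.
Qed.

End increments_functional.

Lemma cylinder_evaluation (R : realType) (t a : R) : 0 <= t ->
  cylinder_functional [:: t] (fun v => v t - a).
Proof.
move=> t0; split.
- by move=> s; rewrite inE => /eqP ->.
- move=> e e0; exists e => // v v' H; rewrite opprD addrACA subrr addr0.
  by apply: H; rewrite inE.
- by move=> d T V mV; apply: measurable_funB => //; apply: mV; rewrite inE.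
Qed.

Section laws_of_rays.
Context d (T : measurableType d) (R : realType) (P : probability T R).
Implicit Types (V : nat -> T -> R) (B : nat -> set R).

(** Rays are replaced by Borel sets one coordinate at a time. The other coordinates are kept as a
    restriction of [P], and two finite measures on the line that agree on rays are equal. *)
Lemma laws_of_rays V V' n :
  (forall i, (i < n)%N -> measurable_fun setT (V i)) ->
  (forall i, (i < n)%N -> measurable_fun setT (V' i)) ->
  (forall a : nat -> R, P [set om | forall i, (i < n)%N -> V i om < a i] =
                        P [set om | forall i, (i < n)%N -> V' i om < a i]) ->
  forall B, (forall i, (i < n)%N -> measurable (B i)) ->
  P [set om | forall i, (i < n)%N -> B i (V i om)] =
  P [set om | forall i, (i < n)%N -> B i (V' i om)].
Proof.
move=> mV mV' rays B mB.
(* Coordinates below [k] carry arbitrary Borel sets, the others still rays. *)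
suff key k : (k <= n)%N -> forall B, (forall i, (i < n)%N -> measurable (B i)) ->
    (forall i, (k <= i < n)%N -> exists a, B i = `]-oo, a[%classic) ->
    P [set om | forall i, (i < n)%N -> B i (V i om)] =
    P [set om | forall i, (i < n)%N -> B i (V' i om)].
  by apply: (key n (leqnn n)) => // i /andP[ni]; rewrite ltnNge ni.
elim: k => [_|k IHk kn] {mB}B mB Bray.
  have {}Bray i : exists a, (i < n)%N -> B i = `]-oo, a[%classic.
    by have [ni|ni] := boolP (i < n)%N; [have [a Ba] := Bray i ni; exists a|exists 0].
  have [a Ba] := choice Bray.
  rewrite (_ : [set _ | _] = [set om | forall i, (i < n)%N -> V i om < a i]).
    rewrite rays; congr (P _); apply/seteqP; split=> om H i ni; have := H i ni;
      by rewrite Ba //= in_itv.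
  by apply/seteqP; split=> om H i ni; have := H i ni; rewrite Ba //= in_itv.
pose rest U := [set om : T | forall i, (i < n)%N -> i != k -> B i (U i om)].
have mrest (U : nat -> T -> R) : (forall i, (i < n)%N -> measurable_fun setT (U i)) ->
    measurable (rest U).
  move=> mU; rewrite (_ : rest U = \bigcap_i [set om | (i < n)%N -> i != k -> B i (U i om)]).
    apply: bigcap_measurableType => i _.
    have [/andP[ni ik]|nik] := boolP ((i < n)%N && (i != k)).
      rewrite (_ : [set _ | _] = U i @^-1` B i).
        by rewrite -[X in measurable X]setTI; apply: mU => //; exact: mB.
      by apply/seteqP; split=> om //= H; exact: H.
    rewrite (_ : [set _ | _] = setT) //; apply/seteqP; split=> // om _ ni ik.
    by rewrite ni ik in nik.
  by apply/seteqP; split=> om H i => [_|]; exact: H.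
pose upd (C : set R) i := if i == k then C else B i.
have updE (U : nat -> T -> R) C : [set om | forall i, (i < n)%N -> upd C i (U i om)] =
    U k @^-1` C `&` rest U.
  apply/seteqP; split=> om.
    move=> H; split; first by have := H k kn; rewrite /upd eqxx.
    by move=> i ni ik; have := H i ni; rewrite /upd (negbTE ik).
  by move=> [Ck H] i ni; rewrite /upd; case: eqVneq => [->//|ik]; exact: H.
have BE (U : nat -> T -> R) : [set om | forall i, (i < n)%N -> B i (U i om)] =
    U k @^-1` (B k) `&` rest U.
  rewrite -updE; apply/seteqP; split=> om H i ni; have := H i ni; rewrite /upd;
    by case: eqVneq => // ->.
rewrite !BE.
have rayC (a : R) : P (V k @^-1` `]-oo, a[ `&` rest V) = P (V' k @^-1` `]-oo, a[ `&` rest V').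
  rewrite -!updE; apply: (IHk (ltnW kn)) => i.
    by rewrite /upd => ni; case: eqP => _; [exact: measurable_itv|exact: mB].
  rewrite /upd => /andP[ki ni]; case: eqVneq => ik; first by exists a.
  by apply: Bray; rewrite ni andbT ltn_neqAle eq_sym ik.
have mVk : measurable_fun setT (V k : T -> measurableTypeR R) by exact: (mV k kn).
have mVk' : measurable_fun setT (V' k : T -> measurableTypeR R) by exact: (mV' k kn).
have mR : measurable `<=` <<s @RGenInftyO.G R >>.
  by rewrite -[X in _ `<=` X](RGenInftyO.measurableE R).
have Gm : @RGenInftyO.G R `<=` measurable.
  by move=> _ [a ->]; exact: measurable_itv.
have GI : setI_closed (@RGenInftyO.G R).
  move=> _ _ [a ->] [b ->]; exists (Num.min a b); apply/seteqP; split=> x;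
    rewrite /= !in_itv /= lt_min; first by move=> [-> ->].
  by move/andP.
have Gg (j : nat) : @RGenInftyO.G R `]-oo, j%:R[%classic by exists j%:R.
have Gcov : \bigcup_(j in [set: nat]) `]-oo, (j%:R : R)[%classic = setT.
  apply/seteqP; split=> // x _; exists (Num.truncn x).+1 => //=.
  by rewrite in_itv /= truncnS_gt.
have := @g_sigma_algebra_measure_unique _ R (measurableTypeR R) _ Gm _ Gg Gcov
  (pushforward (mrestr P (mrest V mV)) (V k : T -> measurableTypeR R))
  (pushforward (mrestr P (mrest V' mV')) (V' k : T -> measurableTypeR R)) GI _ _ (B k) (mR _ (mB k kn)).
apply.
- by move=> _ [a ->]; exact: rayC.
- move=> j; apply: (le_lt_trans (probability_le1 P _)); last by rewrite ltry.
  apply: measurableI; last exact: mrest.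
  by rewrite -[X in measurable X]setTI; exact: mVk.
Qed.

End laws_of_rays.

(** * Reduction to paths continuous on the whole line *)

Section nonnegative_times.
Variable R : realType.
Implicit Types (w : R -> R) (t : R).

(** The path is frozen at [w 0] for negative times, which turns continuity on the half-line into
    continuity everywhere. *)
Definition clip w t := w (Num.max 0 t).

Lemma clipE w t : 0 <= t -> clip w t = w t.
Proof. by move=> t0; rewrite /clip max_r. Qed.

Lemma continuous_clip w : {within `[0, +oo[, continuous w} -> continuous (clip w).
Proof.
move=> /subspace_continuousP cw x; apply/cvgrPdist_lt => e e0.
have m0 : (`[0, +oo[%classic : set R) (Num.max 0 x) by rewrite /= in_itv /= le_max lexx.
have /cvgrPdist_lt /(_ e e0) := cw _ m0.
rewrite near_withinE => /nbhs_ballP[r /= r0 Hr].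
near=> y; apply: Hr; last by rewrite /= in_itv /= le_max lexx.
rewrite /ball /=; apply: max_close; first by rewrite subrr normr0.
by near: y; exists r.
Unshelve. all: by end_near.
Qed.

Lemma hit_set_clip w : hit_set (clip w) = hit_set w.
Proof. by apply/seteqP; split=> t [t0]; rewrite /hit_set /= clipE. Qed.

Lemma tau_clip w : tau (clip w) = tau w.
Proof. by rewrite /tau hit_set_clip. Qed.

Lemma gtau_clip w : gtau (clip w) = gtau w.
Proof.
by rewrite /gtau tau_clip; congr sup; apply/seteqP; split=> t [t0 [tt]]; rewrite /= clipE.
Qed.

Lemma qtr_clip w t : {within `[0, +oo[, continuous w} -> w 0 = 0 -> 0 <= t ->
  qtr (clip w) t = qtr w t.
Proof.
move=> cw w0 t0; rewrite /qtr hit_set_clip tau_clip gtau_clip.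
have [h0|nh] := pselect (hit_set w !=set0); last by rewrite asboolF // clipE.
rewrite (asboolT h0).
have h0' : hit_set (clip w) !=set0 by rewrite hit_set_clip.
have cw' := continuous_clip cw; have w0' : clip w 0 = 0 by rewrite clipE.
have [tau0 _ _] := tauP cw' w0' h0'; have [g0 _ _ _] := gtauP cw' w0' h0'.
rewrite tau_clip in tau0; rewrite gtau_clip in g0.
rewrite !(clipE w (ltW tau0)) !(clipE w t0).
case: ifP => // _; case: ltP => // tt.
(* The reflected time [gtau w + tau w - t] is nonnegative because [t < tau w]. *)
by rewrite !clipE //; lra.
Qed.

End nonnegative_times.

Section invariance.
Context d (T : measurableType d) (R : realType) (P : probability T R).
Implicit Types (W : T -> R -> R).

Lemma brownian_eq_on_nonneg W W' : (forall om t, 0 <= t -> W' om t = W om t) ->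
  is_brownian_motion P W -> is_brownian_motion P W'.
Proof.
move=> WW [mW W0 cW law]; split.
- by move=> t t0; under eq_fun do rewrite WW //; exact: mW.
- by move=> om; rewrite WW.
- move=> om; apply: (@subspace_eq_continuous _ _ _ (W om)); last exact: cW.
  by move=> t /set_mem; rewrite /= in_itv /= andbT => t0; rewrite /from_subspace /= WW.
move=> n ts B ts0 tsi mB; rewrite -law //; congr (P _).
have tsn i : (i <= n)%N -> 0 <= ts i.
  by elim: i => // i IHi ni; rewrite (le_trans (IHi (ltnW ni))) // ltW // tsi.
apply: eq_bigcapr => i /= ni; apply/seteqP; split=> om /=; by rewrite !WW ?tsn // ltnW.
Qed.

Lemma qtr_at0 (w : R -> R) : continuous w -> w 0 = 0 -> qtr w 0 = 0.
Proof.
move=> cw w0; have [h0|nh] := pselect (hit_set w !=set0); last by rewrite /qtr asboolF.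
rewrite qtrE //; have [g0 gt wg _] := gtauP cw w0 h0.
rewrite thetaE ?(ltW gt) //; case: ltP => // g0'.
(* If the last zero is 0, time 0 lies in the reversed part, where [w (tau w)] cancels. *)
have -> : gtau w = 0 by apply/eqP; rewrite eq_le g0 g0'.
have [-> _ _] := tauP cw w0 h0.
by rewrite add0r subr0 w0; ring.
Qed.

Lemma continuous_qtr (w : R -> R) : continuous w -> w 0 = 0 -> continuous (qtr w).
Proof.
move=> cw w0; have [h0|nh] := pselect (hit_set w !=set0).
  rewrite (_ : qtr w = theta (gtau w) (tau w) w); first exact: continuous_theta.
  by apply/funext => t; exact: qtrE.
by rewrite (_ : qtr w = w) //; apply/funext => t; rewrite /qtr asboolF.
Qed.

(** Evaluation functionals give measurable coordinates, and increment margins give the increments on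
    rays, hence on Borel sets. *)
Lemma brownian_qtr_continuous W : is_brownian_motion P W ->
  (forall om, continuous (W om)) -> is_brownian_motion P (fun om => qtr (W om)).
Proof.
move=> bm cW; have [mW W0 _ law] := bm.
have mq t : 0 <= t -> measurable_fun setT (fun om => qtr (W om) t).
  move=> t0; apply: (measurability _ (RGenOInfty.measurableE R)) => //.
  move=> _ [_ [a ->] <-]; rewrite setTI.
  have := (qtr_le bm cW (cylinder_evaluation a t0)).1.
  rewrite (_ : [set _ | _] = (fun om => qtr (W om) t) @^-1` `]a, +oo[) //.
  by apply/seteqP; split=> om; rewrite /= in_itv /= andbT subr_gt0.
split=> //.
- by move=> om; exact: qtr_at0.
- by move=> om; apply: continuous_subspaceT; exact: continuous_qtr.
move=> n ts B ts0 tsi mB; rewrite -law //.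
have tsn i : (i <= n)%N -> 0 <= ts i.
  by elim: i => // i IHi ni; rewrite (le_trans (IHi (ltnW ni))) // ltW // tsi.
apply: (@laws_of_rays _ _ _ P (fun i om => qtr (W om) (ts i.+1) - qtr (W om) (ts i))
  (fun i om => W om (ts i.+1) - W om (ts i))) => //.
- by move=> i ni; apply: measurable_funB; apply: mq; apply: tsn => //; exact: ltnW.
- by move=> i ni; apply: measurable_funB; apply: mW; apply: tsn => //; exact: ltnW.
move=> a; have := qtr_eq bm cW (cylinder_increments_margin a tsn).
have E (V : T -> R -> R) : [set om | 0 < increments_margin ts a (iota 0 n) (V om)] =
    [set om | forall i, (i < n)%N -> V om (ts i.+1) - V om (ts i) < a i].
  apply/seteqP; split=> om; last first.
    by move=> H; apply/increments_margin_gt0 => i; rewrite mem_iota => /H.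
  by move=> /increments_margin_gt0 H i ni; apply: H; rewrite mem_iota.
by rewrite (E (fun om => qtr (W om))) E.
Qed.

End invariance.

Theorem theorem2p1 (d : measure_display) (T : measurableType d) (R : realType)
    (P : probability T R) (W : T -> R -> R) :
  is_brownian_motion P W ->
  is_brownian_motion P (fun om => qtr (W om)).
Proof.
move=> bm; have [_ W0 cW _] := bm.
apply: (@brownian_eq_on_nonneg _ _ _ P (fun om => qtr (clip (W om)))).
  by move=> om t t0; rewrite qtr_clip.
apply: brownian_qtr_continuous; last by move=> om; exact: continuous_clip.
by apply: brownian_eq_on_nonneg bm => om t; exact: clipE.
Qed.
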